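(* Let $p\in\mathbb R_{\ge1}$. Let $X\in\Omega^p(V)$ and let $H,\widetilde H\in\mathscr H^p(V)$. Then $$(X\boxplus H)\boxplus\widetilde H=X\boxplus(H\boxplus\widetilde H).$$
   Context: Setting. $J=[S,T]$ is a fixed compact interval and $\triangle_J=\{(s,t)\in J^2: s\le t\}$. $V$ is a Banach space; $V^{\otimes n}$ ($V^{\otimes 0}=\mathbb R$) denotes its completed tensor powers with admissible norms: permutations in $S_n$ act by isometries on $V^{\otimes n}$, and $\|v\otimes w\|\le\|v\|\|w\|$. $T^{(k)}(V)=\bigoplus_{i=0}^kV^{\otimes i}$ with product $(a\otimes b)^i=\sum_{j=0}^i a^j\otimes b^{i-j}$; $a^i$ is the level-$i$ component. A control on $J$ is a continuous $\omega:\triangle_J\to[0,\infty)$ with $\omega(t,t)=0$ and $\omega(s,u)+\omega(u,t)\le\omega(s,t)$ for $s\le u\le t$. Put $x!:=\Gamma(x+1)$, $\beta(p)=p\bigl(1+\sum_{r=3}^\infty(\frac{2}{r-2})^{(\lfloor p\rfloor+1)/p}\bigr)$. A map $X:\triangle_J\to T^{(k)}(V)$ has finite $p$-variation controlled by $\omega$ with constant $K$ if $\|X^i_{s,t}\|\le K\,\omega(s,t)^{i/p}/(\beta(p)(i/p)!)$ for $i=1,\dots,k$, $(s,t)\in\triangle_J$. A multiplicative functional of degree $k$ is a continuous $X:\triangle_J\to T^{(k)}(V)$ with $X^0\equiv1$ and $X_{s,u}\otimes X_{u,t}=X_{s,t}$ for $s\le u\le t$. $\Omega^{(k,p)}(V)$: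 those of finite $p$-variation for some control and constant; $\Omega^p(V):=\Omega^{(\lfloor p\rfloor,p)}(V)$ ($p$-rough paths). Sewing. For $\theta>1$, $\Omega^{\mathrm{am},(k,p)}_{\theta,\omega}(V)$ is the set of maps $X=(1,X^1,\dots,X^k):\triangle_J\to T^{(k)}(V)$ that for some $K\ge0$ have finite $p$-variation controlled by $\omega$ with constant $K$ and satisfy $\|(X_{s,u}\otimes X_{u,t}-X_{s,t})^i\|\le K\omega(s,t)^\theta$ for $s\le u\le t$, $i=1,\dots,k$. By Lyons' rough sewing lemma, for such $X$ there is a unique multiplicative functional $\bar X$ of degree $k$ with finite $p$-variation such that $\|\bar X^i_{s,t}-X^i_{s,t}\|\le C\omega(s,t)^\theta$ for some $C$ and all $(s,t)$, $i=1,\dots,k$; it is independent of the witnessing $(p,\theta,\omega)$ and denoted $\mathscr S^k(X)$. $\mathscr H^p(V)$ is the set of $H\in\Omega^p(V)$ for which there are a control $\omega$, $\phi\in(1-\frac1p,1]$ and $K\ge0$ with $\|H^j_{s,t}\|\le K\omega(s,t)^\phi$ for $j=1,\dots,\lfloor p\rfloor$, $(s,t)\in\triangle_J$. For $X\in\Omega^p(V)$, $H\in\mathscr H^p(V)$ let $(X\oplus H)_{s,t}:=(1,X^1_{s,t}+H^1_{s,t},\dots,X^{\lfloor p\rfloor}_{s,t}+H^{\lfloor p\rfloor}_{s,t})$; this lies in some $\Omega^{\mathrm{am},(\lfloor p\rfloor,p)}_{\theta,\omega}(V)$, and $X\boxplus H:=\mathscr S^{\lfloor p\rfloor}(X\oplus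 H)\in\Omega^p(V)$. If also $X\in\mathscr H^p(V)$ then $X\boxplus H\in\mathscr H^p(V)$. *)

(* Defs.v *)
From HB Require Import structures.
From mathcomp Require Import all_boot all_order all_algebra all_fingroup.
From mathcomp Require Import all_classical all_reals all_analysis.

Set Implicit Arguments.
Unset Strict Implicit.
Unset Printing Implicit Defensive.

Import Order.TTheory GRing.Theory Num.Theory.
Import numFieldNormedType.Exports.

Local Open Scope classical_set_scope.
Local Open Scope ring_scope.

Section TensorPowers.
Context {R : realType} (V : completeNormedModType R).

(* [tpow E n] is the Banach space $V^{\otimes n}$; the identifications
   $V^{\otimes 0} = \mathbb R$ and $V^{\otimes 1} = V$ are the maps [tinj0] and
   [tinj1]. *)
Record tensor_data := TensorData {
  tpow : nat -> completeNormedModType R;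
  tinj0 : {linear R^o -> tpow 0};
  tinj1 : {linear V -> tpow 1};
  tmul : forall m n, {bilinear tpow m -> tpow n -> tpow (m + n)} }.

Variable E : tensor_data.

Definition tpow_cast m n (e : m = n) (x : tpow E m) : tpow E n :=
  ecast i (tpow E i) e x.

(* $v_0 \otimes \dots \otimes v_{n-1}$ *)
Fixpoint pure_tensor n : ('I_n -> V) -> tpow E n :=
  match n return ('I_n -> V) -> tpow E n with
  | 0 => fun _ => tinj0 E 1
  | m.+1 => fun v =>
      tmul E 1 m (tinj1 E (v ord0)) (pure_tensor (fun i => v (lift ord0 i)))
  end.

Definition update n (v : 'I_n -> V) (i : 'I_n) (x : V) : 'I_n -> V :=
  fun j => if j == i then x else v j.

Definition multilinear n (W : lmodType R) (f : ('I_n -> V) -> W) : Prop :=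
  forall (v : 'I_n -> V) (i : 'I_n) (a : R) (x y : V),
    f (update v i (a *: x + y)) = a *: f (update v i x) + f (update v i y).

(* [ts_free] and [ts_dense] say that $V^{\otimes n}$ is a completion of the
   algebraic tensor power: every multilinear map factors through the linear
   span of the pure tensors (so that this span is the algebraic tensor power),
   and that span is dense. *)
Record admissible_tensor_powers : Prop := AdmissibleTensorPowers {
  ts_inj0_bij : bijective (tinj0 E);
  ts_inj0_norm : forall c, `|tinj0 E c| = `|c|;
  ts_inj1_bij : bijective (tinj1 E);
  ts_inj1_norm : forall v, `|tinj1 E v| = `|v|;
  ts_mul0l : forall n c (x : tpow E n), tmul E 0 n (tinj0 E c) x = c *: x;
  ts_mul0r : forall n c (x : tpow E n),
    tpow_cast (addn0 n) (tmul E n 0 x (tinj0 E c)) = c *: x;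
  ts_mulA : forall m n k (x : tpow E m) (y : tpow E n) (z : tpow E k),
    tpow_cast (addnA m n k) (tmul E m (n + k) x (tmul E n k y z)) =
    tmul E (m + n) k (tmul E m n x y) z;
  ts_free : forall n (W : lmodType R) (f : ('I_n -> V) -> W),
    multilinear f ->
    forall r (c : 'I_r -> R) (v : 'I_r -> 'I_n -> V),
      \sum_(l < r) c l *: pure_tensor (v l) = 0 ->
      \sum_(l < r) c l *: f (v l) = 0;
  ts_dense : forall n,
    closure [set x : tpow E n | exists r (c : 'I_r -> R) (v : 'I_r -> 'I_n -> V),
      x = \sum_(l < r) c l *: pure_tensor (v l)] = setT;
  ts_perm : forall n (s : 'S_n), exists f : {linear tpow E n -> tpow E n},
    (forall v, f (pure_tensor v) = pure_tensor (v \o s)) /\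
    (forall x, `|f x| = `|x|);
  ts_mul_norm : forall m n (x : tpow E m) (y : tpow E n),
    `|tmul E m n x y| <= `|x| * `|y| }.

(* $T^{(k)}(V)$ with the product topology *)
Definition ttensor (k : nat) : topologicalType :=
  prod_topology (fun i : 'I_k.+1 => tpow E i).

Definition tone_level (n : nat) : tpow E n :=
  match n return tpow E n with 0 => tinj0 E 1 | _.+1 => 0 end.

Definition sub_lt k (i : 'I_k.+1) (j : nat) : (i - j < k.+1)%N :=
  leq_ltn_trans (leq_subr j i) (ltn_ord i).

Definition ttmul k (a b : ttensor k) : ttensor k := fun i =>
  \sum_(j < i.+1) tpow_cast (subnKC (leq_ord j))
    (tmul E j (i - j) (a (widen_ord (ltn_ord i) j)) (b (Ordinal (sub_lt i j)))).

End TensorPowers.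

Section RoughPaths.
Context {R : realType} (S T : R).

Definition triangle : set (R * R) :=
  [set st | S <= st.1 /\ st.1 <= st.2 /\ st.2 <= T].

Definition control (w : R * R -> R) : Prop :=
  [/\ {within triangle, continuous w},
      forall st, triangle st -> 0 <= w st,
      forall t, S <= t <= T -> w (t, t) = 0 &
      forall s u t, S <= s -> s <= u -> u <= t -> t <= T ->
        w (s, u) + w (u, t) <= w (s, t)].

Definition Gamma (x : R) : R :=
  \int[lebesgue_measure]_(t in `]0, +oo[) (t `^ (x - 1) * expR (- t)).

Definition rfact (x : R) : R := Gamma (x + 1).

Definition beta_const (p : R) : R :=
  p * (1 + \big[+%R/0]_(3 <= r <oo)
    (2 / (r%:R - 2)) `^ ((Num.truncn p).+1%:R / p)).

Context {V : completeNormedModType R} (E : tensor_data V).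

(* Maps on the triangle are represented by total functions on the plane, whose
   values off the triangle are irrelevant. *)
Local Notation path k := (R * R -> ttensor E k).

Definition controlled_variation k (p : R) (w : R * R -> R) (K : R)
    (X : path k) : Prop :=
  forall st, triangle st -> forall i : 'I_k.+1, (0 < i)%N ->
    `|X st i| <= K * w st `^ (i%:R / p) / (beta_const p * rfact (i%:R / p)).

Definition level0_one k (X : path k) : Prop :=
  forall st, triangle st -> X st ord0 = tinj0 E 1.

Definition multiplicative_functional k (X : path k) : Prop :=
  [/\ {within triangle, continuous X}, level0_one X &
      forall s u t, S <= s -> s <= u -> u <= t -> t <= T ->
        ttmul (X (s, u)) (X (u, t)) = X (s, t)].

(* $\Omega^{(k,p)}(V)$ *)
Definition Omega k (p : R) (X : path k) : Prop :=
  multiplicative_functional X /\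
  exists (w : R * R -> R) (K : R), [/\ control w, 0 <= K & controlled_variation p w K X].

(* $\Omega^{\mathrm{am},(k,p)}_{\theta,\omega}(V)$ *)
Definition Omega_am k (p theta : R) (w : R * R -> R) (X : path k) : Prop :=
  level0_one X /\
  exists K : R, [/\ 0 <= K, controlled_variation p w K X &
    forall s u t, S <= s -> s <= u -> u <= t -> t <= T ->
      forall i : 'I_k.+1, (0 < i)%N ->
      `|ttmul (X (s, u)) (X (u, t)) i - X (s, t) i| <= K * w (s, t) `^ theta].

Definition is_sewing k (X Y : path k) : Prop :=
  exists (p theta : R) (w : R * R -> R),
    [/\ 1 <= p, 1 < theta, control w, Omega_am p theta w X & Omega p Y /\
      exists C : R, forall st, triangle st -> forall i : 'I_k.+1, (0 < i)%N ->
        `|Y st i - X st i| <= C * w st `^ theta].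

(* $\mathscr S^k(X)$; [is_sewing] determines it on the triangle. *)
Definition sewing k (X : path k) : path k := get (is_sewing X).

Definition rough_path (p : R) (X : path (Num.truncn p)) : Prop := Omega p X.

(* $\mathscr H^p(V)$ *)
Definition Hspace (p : R) (H : path (Num.truncn p)) : Prop :=
  rough_path H /\
  exists (w : R * R -> R) (phi K : R), [/\ control w, 1 - p^-1 < phi, phi <= 1, 0 <= K &
    forall st, triangle st -> forall j : 'I_(Num.truncn p).+1, (0 < j)%N ->
      `|H st j| <= K * w st `^ phi].

Definition oplus k (X H : path k) : path k := fun st i =>
  if i == 0%N :> nat then tone_level E i else X st i + H st i.

Definition boxplus k (X H : path k) : path k := sewing (oplus X H).

End RoughPaths.

Arguments rough_path {R} S T {V E} p X.
Arguments Hspace {R} S T {V E} p H.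

(* Main.v *)
Require Import Defs.
From mathcomp Require Import all_boot all_order all_algebra.
From mathcomp Require Import all_classical all_reals all_analysis.
From mathcomp Require Import measurable_realfun.
From mathcomp Require Import ring lra.

Set Implicit Arguments.
Unset Strict Implicit.
Unset Printing Implicit Defensive.

Import Order.TTheory GRing.Theory Num.Theory.
Import numFieldNormedType.Exports.

Local Open Scope classical_set_scope.
Local Open Scope ring_scope.

(** The operation boxplus sews the pointwise sum oplus, and oplus is
    associative on the nose.  The proof turns this into a computation with the
    relation [close]: two maps are close when, on every positive level, their
    difference is bounded by a power greater than 1 of some control.  Closeness
    is an equivalence relation and a congruence for oplus ([close_oplus]), and
    X boxplus H is close to X oplus H ([boxplusP]).  Hence both sides of the
    theorem are close to X oplus H oplus H'.  Both are multiplicative, and close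
    multiplicative functionals coincide ([chen_unique]): at the lowest level
    where they could differ, their difference is additive in the interval and
    bounded by a control to a power greater than 1, so summing it over finer and
    finer partitions gives 0.

    For X boxplus H to mean anything, the rough sewing lemma is proved
    ([rough_sewing]), one tensor level at a time.  When a map satisfies Chen's
    identity below level m, adding to its level m the cross terms between the
    intervals [S, s] and [s, t] turns Chen's identity at level m into plain
    additivity, by associativity of the truncated tensor product
    ([cross_cocycle]); so level m is repaired by the sewing lemma for additive
    functions ([additive_sewing]).  The sum oplus is almost multiplicative
    because its defect consists of the mixed products of X and H only, which are
    of order 1/p + phi > 1 ([oplus_almost_chen]).

    Controls enter through clocks, that is, strictly increasing continuous
    functions h: every control is dominated by the increments h t - h s of a
    clock ([control_clock]), and such increments are themselves controls.
    Partitions equidistant in clock time then make all sewing estimates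
    geometric series.  Statements of the form: there is a control for which F is
    O(omega^a), are packaged in [of_order a F], which is stable under sums and
    products, so that no particular control has to be carried along. *)

(** * Clocks and orders of vanishing *)

Section Orders.
Context {R : realType}.
Implicit Types (a b x y : R).

Lemma powR_mono_base a x y : 0 <= a -> 0 <= x -> x <= y -> x `^ a <= y `^ a.
Proof.
by move=> a0 x0 xy; apply: ge0_ler_powR; rewrite ?nnegrE//; exact: le_trans xy.
Qed.

Lemma powR_add a b x : 0 <= a -> 0 <= b -> 0 <= x ->
  x `^ (a + b) = x `^ a * x `^ b.
Proof.
move=> a0 b0; rewrite le_eqVlt => /predU1P[<-|x0]; last first.
  by rewrite powRD// (gt_eqF x0) implybT.
have [->|an0] := eqVneq a 0; first by rewrite add0r powRr0 mul1r.
by rewrite (powR0 an0) mul0r powR0 // paddr_eq0 // negb_and an0.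
Qed.

Lemma powR_weaken a b x y : 0 <= a -> a <= b -> 0 <= x -> x <= y ->
  x `^ b <= y `^ (b - a) * x `^ a.
Proof.
move=> a0 ab x0 xy; have ba0 : 0 <= b - a by rewrite subr_ge0.
rewrite (_ : x `^ b = x `^ (b - a) * x `^ a); last by rewrite -powR_add// subrK.
by apply: ler_wpM2r; [exact: powR_ge0|exact: powR_mono_base].
Qed.

(** Continuity and monotonicity are asked on the whole line, so that sums and
    increments of clocks need no side conditions; [control_clock] extends by
    clamping. *)
Definition clock (h : R -> R) := continuous h /\ {homo h : x y / x < y}.

Lemma clock_le h x y : clock h -> x <= y -> h x <= h y.
Proof. by case=> _ hlt; rewrite le_eqVlt => /predU1P[->//|/hlt/ltW]. Qed.

Lemma clockD h g : clock h -> clock g -> clock (fun x => h x + g x).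
Proof.
move=> [ch mh] [cg mg]; split; first by move=> x; apply: cvgD; [exact: ch|exact: cg].
by move=> x y xy; apply: ltrD; [exact: mh|exact: mg].
Qed.

Lemma clock_id : clock id.
Proof. by split=> // x; exact: cvg_id. Qed.

Definition clamp s t x := Num.max s (Num.min x t).

Lemma clamp_itv s t x : s <= t -> s <= clamp s t x <= t.
Proof.
by move=> st; rewrite /clamp le_max lexx/= ge_max st ge_min lexx orbT.
Qed.

Lemma le_clamp s t x y : x <= y -> clamp s t x <= clamp s t y.
Proof. by move=> xy; rewrite /clamp le_max2// le_min2. Qed.

Lemma clamp_id s t x : s <= x <= t -> clamp s t x = x.
Proof. by move=> /andP[sx xt]; rewrite /clamp min_l// max_r. Qed.

Lemma clamp_left s u t x : s <= u -> u <= t ->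
  clamp s u x = Num.min (clamp s t x) u.
Proof.
move=> su ut; rewrite /clamp.
by rewrite !minEle !maxEle; do ?case: ifP; intros; lra.
Qed.

Lemma clamp_right s u t x : s <= u -> u <= t ->
  clamp u t x = Num.max (clamp s t x) u.
Proof.
move=> su ut; rewrite /clamp.
by rewrite !minEle !maxEle; do ?case: ifP; intros; lra.
Qed.

(** Clamping is a contraction for the distance measured by a clock, so it does not
    increase the mesh of a partition. *)
Lemma clock_clamp (h : R -> R) s t x y : clock h -> s <= t -> x <= y ->
  h (clamp s t y) - h (clamp s t x) <= h y - h x.
Proof.
move=> ch st xy; have hxy := clock_le ch xy.
have [ys|sy] := leP y s.
  have E z : z <= s -> clamp s t z = s.
    by move=> zs; rewrite /clamp min_l ?(le_trans zs)// max_l.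
  by rewrite !E ?(le_trans xy)// subrr subr_ge0.
have [tx|xt] := leP t x.
  have E z : t <= z -> clamp s t z = t.
    by move=> tz; rewrite /clamp min_r// max_r.
  by rewrite !E ?(le_trans tx)// subrr subr_ge0.
apply: lerB; apply: clock_le ch _; rewrite /clamp.
  by rewrite ge_max (ltW sy) ge_min lexx.
by rewrite (min_l (ltW xt)) le_max lexx orbT.
Qed.
Context (S T : R).

(** [F s u t] may depend on an intermediate time because multiplicative defects
    do; a bound for a function of the interval alone is the special case in which
    u is ignored.  The clock is existentially quantified, and differs from one
    instance to the next. *)
Definition of_order a (F : R -> R -> R -> R) :=
  exists (h : R -> R) (K : R), [/\ clock h, 0 <= K &
    forall s u t, S <= s -> s <= u -> u <= t -> t <= T ->
      F s u t <= K * (h t - h s) `^ a].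

Lemma of_order_le a F G : of_order a G ->
  (forall s u t, S <= s -> s <= u -> u <= t -> t <= T -> F s u t <= G s u t) ->
  of_order a F.
Proof.
move=> [h [K [ch K0 GK]]] FG; exists h, K; split=> // s u t Ss su ut tT.
by apply: le_trans (FG _ _ _ _ _ _ _) (GK _ _ _ _ _ _ _).
Qed.

Lemma of_order0 a : of_order a (fun _ _ _ => 0).
Proof. by exists id, 0; split=> [||*]; [exact: clock_id| |rewrite mul0r]. Qed.

Lemma of_orderD a F G : 0 <= a -> of_order a F -> of_order a G ->
  of_order a (fun s u t => F s u t + G s u t).
Proof.
move=> a0 [h [K [ch K0 FK]]] [g [L [cg L0 GL]]].
exists (fun x => h x + g x), (K + L); split; [exact: clockD|exact: addr_ge0|].
move=> s u t Ss su ut tT; have st := le_trans su ut.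
have hst := clock_le ch st; have gst := clock_le cg st.
rewrite mulrDl; apply: lerD.
  apply: le_trans (FK _ _ _ Ss su ut tT) _; rewrite ler_wpM2l// powR_mono_base//; lra.
apply: le_trans (GL _ _ _ Ss su ut tT) _; rewrite ler_wpM2l// powR_mono_base//; lra.
Qed.

Lemma of_orderM a b F G : 0 <= a -> 0 <= b ->
  (forall s u t, 0 <= F s u t) -> (forall s u t, 0 <= G s u t) ->
  of_order a F -> of_order b G ->
  of_order (a + b) (fun s u t => F s u t * G s u t).
Proof.
move=> a0 b0 F0 G0 [h [K [ch K0 FK]]] [g [L [cg L0 GL]]].
exists (fun x => h x + g x), (K * L); split; [exact: clockD|exact: mulr_ge0|].
move=> s u t Ss su ut tT; have st := le_trans su ut.
have hst := clock_le ch st; have gst := clock_le cg st.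
rewrite powR_add//; last by lra.
rewrite mulrACA; apply: ler_pM => //.
  apply: le_trans (FK _ _ _ Ss su ut tT) _; rewrite ler_wpM2l// powR_mono_base//; lra.
apply: le_trans (GL _ _ _ Ss su ut tT) _; rewrite ler_wpM2l// powR_mono_base//; lra.
Qed.

(** The clock increments are bounded on the compact interval, so the excess power
    goes into the constant. *)
Lemma of_order_weaken a b F : 0 <= a -> a <= b -> of_order b F -> of_order a F.
Proof.
move=> a0 ab [h [K [ch K0 FK]]].
exists h, (K * (h T - h S) `^ (b - a)); split=> //.
  by rewrite mulr_ge0// powR_ge0.
move=> s u t Ss su ut tT; have st := le_trans su ut.
apply: le_trans (FK _ _ _ Ss su ut tT) _; rewrite -mulrA ler_wpM2l// powR_weaken//.
  by rewrite subr_ge0 clock_le.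
by apply: lerB; exact: clock_le.
Qed.

Lemma of_order_sum a I (r : seq I) (P : pred I) (F : I -> R -> R -> R -> R) :
  0 <= a -> (forall i, P i -> of_order a (F i)) ->
  of_order a (fun s u t => \sum_(i <- r | P i) F i s u t).
Proof.
move=> a0 HF; elim: r => [|i r IH].
  by apply: of_order_le (of_order0 a) _ => *; rewrite big_nil.
case: (boolP (P i)) => Pi.
  by apply: of_order_le (of_orderD a0 (HF i Pi) IH) _ => *; rewrite big_cons Pi.
by apply: of_order_le IH _ => *; rewrite big_cons (negbTE Pi).
Qed.

Lemma of_order_left a (F : R -> R -> R) : 0 <= a ->
  of_order a (fun s _ t => F s t) -> of_order a (fun s u _ => F s u).
Proof.
move=> a0 [h [K [ch K0 FK]]]; exists h, K; split=> // s u t Ss su ut tT.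
apply: le_trans (FK s s u _ _ _ _) _ => //; first exact: le_trans ut tT.
apply: ler_wpM2l => //; apply: powR_mono_base => //.
  by rewrite subr_ge0 clock_le.
by apply: lerB; exact: clock_le.
Qed.

Lemma of_order_right a (F : R -> R -> R) : 0 <= a ->
  of_order a (fun s _ t => F s t) -> of_order a (fun _ u t => F u t).
Proof.
move=> a0 [h [K [ch K0 FK]]]; exists h, K; split=> // s u t Ss su ut tT.
apply: le_trans (FK u u t _ _ _ _) _ => //; first exact: le_trans su.
apply: ler_wpM2l => //; apply: powR_mono_base => //.
  by rewrite subr_ge0 clock_le.
by apply: lerB; exact: clock_le.
Qed.

(** The sum of the individual clocks dominates each of them. *)
Lemma of_order_common (I : finType) (a : I -> R) (F : I -> R -> R -> R -> R) :
  (forall i, 0 <= a i) -> (forall i, of_order (a i) (F i)) ->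
  exists (h : R -> R) (K : R), [/\ clock h, 0 <= K &
    forall i s u t, S <= s -> s <= u -> u <= t -> t <= T ->
      F i s u t <= K * (h t - h s) `^ a i].
Proof.
move=> a0 HF.
suff: exists (h : R -> R) (K : R), [/\ clock h, 0 <= K &
    forall i, i \in enum I ->
    forall s u t, S <= s -> s <= u -> u <= t -> t <= T ->
      F i s u t <= K * (h t - h s) `^ a i].
  move=> [h [K [ch K0 HK]]]; exists h, K; split=> // i; apply: HK.
  by rewrite mem_enum.
elim: (enum I) => [|j r [h [K [ch K0 IH]]]].
  by exists id, 0; split=> //; exact: clock_id.
have [g [L [cg L0 GL]]] := HF j.
exists (fun x => h x + g x), (K + L); split; [exact: clockD|exact: addr_ge0|].
move=> i; rewrite inE => ir s u t Ss su ut tT; have st := le_trans su ut.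
have hst := clock_le ch st; have gst := clock_le cg st.
case/orP: ir => [/eqP ->|ir].
  apply: le_trans (GL _ _ _ Ss su ut tT) _; apply: ler_pM => //.
  - exact: powR_ge0.
  - lra.
  - by rewrite powR_mono_base//; lra.
apply: le_trans (IH _ ir _ _ _ Ss su ut tT) _; apply: ler_pM => //.
- exact: powR_ge0.
- lra.
- by rewrite powR_mono_base//; lra.
Qed.

Lemma clock_control h : clock h -> control S T (fun st => h st.2 - h st.1).
Proof.
move=> ch; split.
- apply: continuous_subspaceT => -[x y]; apply: cvgB => /=.
  + by apply: (cvg_comp _ _ cvg_snd); exact: ch.1.
  + by apply: (cvg_comp _ _ cvg_fst); exact: ch.1.
- by move=> [s t] [_ [/= st _]]; rewrite subr_ge0 clock_le.
- by move=> t _; rewrite /= subrr.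
- by move=> s u t *; rewrite /=; lra.
Qed.

(** Superadditivity bounds w(s,t) by w(S,t) - w(S,s); adding the identity makes the
    clock strictly increasing where w degenerates. *)
Lemma control_clock w : S <= T -> control S T w ->
  exists2 h, clock h &
    forall s t, S <= s -> s <= t -> t <= T -> w (s, t) <= h t - h s.
Proof.
move=> ST [cw w0 wd wa].
have clST x := clamp_itv x ST.
have wmono x y : S <= x -> x <= y -> y <= T -> w (S, x) + w (x, y) <= w (S, y).
  by move=> Sx xy yT; exact: wa.
exists (fun x => w (S, clamp S T x) + x).
  split.
    move=> x; apply: cvgD; last exact: cvg_id.
    have /subspace_continuousP := cw; move/(_ (S, clamp S T x)).
    have tr y : triangle S T (S, clamp S T y).
      by have /andP[] := clST y; rewrite /triangle/=; split.
    move=> /(_ (tr x)) cwx.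
    have ccl : clamp S T @ x --> clamp S T x.
      apply: (@continuous_max _ _ (fun=> S) (fun y => Num.min y T)).
        exact: cvg_cst.
      by apply: (@continuous_min _ _ id (fun=> T)); [exact: cvg_id|exact: cvg_cst].
    have cS : (fun y => (S, clamp S T y)) @ x --> (S, clamp S T x).
      apply: (@cvg_pair _ _ _ (nbhs x) (nbhs S) (nbhs (clamp S T x)) _ _ _
        (fun=> S) (clamp S T)) => //.
      exact: cvg_cst.
    suff cS' : (fun y => (S, clamp S T y)) @ x -->
        within (triangle S T) (nbhs (S, clamp S T x)).
      exact: (cvg_comp _ _ cS' cwx).
    move=> A nA; have := cS _ nA; rewrite /fmap/= => nA'.
    by apply: (@filterS _ (nbhs x) _ _ _ _ nA') => y /= yA; exact/yA/tr.
  move=> x y xy; apply: ler_ltD => //.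
  have /andP[Sx xT] := clST x; have /andP[Sy yT] := clST y.
  have := wmono _ _ Sx (le_clamp S T (ltW xy)) yT.
  have : 0 <= w (clamp S T x, clamp S T y).
    by apply: w0; split=> //=; split=> //; exact/le_clamp/ltW.
  lra.
move=> s t Ss st tT; rewrite !clamp_id ?Ss ?tT ?(le_trans Ss st) ?(le_trans st tT)//.
have := wmono _ _ Ss st tT; lra.
Qed.
End Orders.

(** * Additive sewing *)

Section GeometricLimits.
Context {R : realType}.

(** The bound on the distance to the limit is the point: it gives the estimate
    between a sewn function and its germ. *)
Lemma geometric_increments_cvg (B : completeNormedModType R) (u : nat -> B)
    (C r : R) : 0 <= C -> 0 <= r -> r < 1 ->
  (forall n, `|u n.+1 - u n| <= C * r ^+ n) ->
  exists l, u @ \oo --> l /\ `|l - u 0%N| <= C / (1 - r).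
Proof.
move=> C0 r0 r1 Hu.
have r1' : `|r| < 1 by rewrite ger0_norm.
have cs : cvgn (series (fun n => u n.+1 - u n)).
  apply: normed_cvg; apply: (@series_le_cvg _ _ (geometric C r)) => [n|n|n|] //=.
  - exact: mulr_ge0 (exprn_ge0 _ _).
  - exact: is_cvg_geometric_series.
have uE n : u n = u 0%N + series (fun n => u n.+1 - u n) n.
  by rewrite /series/= telescope_sumr// addrC subrK.
exists (u 0%N + limn (series (fun n => u n.+1 - u n))).
have cu : u @ \oo --> u 0%N + limn (series (fun n => u n.+1 - u n)).
  rewrite [X in X @ _](funext uE); apply: cvgD; [exact: cvg_cst|exact: cs].
split=> //.
have cn : (fun n => `|u n - u 0%N|) @ \oo -->
    `|u 0%N + limn (series (fun n => u n.+1 - u n)) - u 0%N|.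
  by apply: cvg_norm; apply: cvgB => //; exact: cvg_cst.
rewrite -(cvg_lim (@Rhausdorff R) cn); apply: limr_le; first exact: cvgP cn.
apply: nearW => n; rewrite uE addrC addKr.
apply: le_trans (ler_norm_sum _ _ _) _.
apply: (@le_trans _ _ (\sum_(0 <= i < n) C * r ^+ i)).
  by apply: ler_sum => i _; exact: Hu.
have r1n : 0 < 1 - r by rewrite subr_gt0.
rewrite ler_pdivlMr// -mulr_sumr -mulrA ler_piMr//.
rewrite big_mkord mulrC -opprB mulNr -subrX1 opprB.
by rewrite lerBlDl lerDr exprn_ge0.
Qed.

Lemma geometric_bound_le0 (x C r : R) : 0 <= r -> r < 1 ->
  (forall n, x <= C * r ^+ n) -> x <= 0.
Proof.
move=> r0 r1 Hx; have c := cvg_geometric C (_ : `|r| < 1).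
have {}c := c (ltac:(by rewrite ger0_norm)).
rewrite -(cvg_lim (@Rhausdorff R) c); apply: limr_ge; first exact: cvgP c.
by apply: nearW => n; exact: Hx.
Qed.

End GeometricLimits.

Section AdditiveSewing.
Context {R : realType} (S T : R) (leST : S <= T).

(** tau is an inverse of the clock rescaled to [0, 1], so that images of dyadic
    numbers are partition points equidistant in clock time.  Strict monotonicity
    of the clock makes any choice of preimages monotone. *)
Lemma dyadic_clock (h : R -> R) : clock h -> exists tau : R -> R,
  [/\ tau 0 = S, tau 1 = T,
      forall x y : R, 0 <= x -> x <= y -> y <= 1 -> tau x <= tau y &
      forall x : R, 0 <= x <= 1 -> h (tau x) = h S + x * (h T - h S)].
Proof.
move=> ch; have hST := clock_le ch leST.
have hinj x y : h x = h y -> x = y.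
  move=> hxy; apply/eqP; rewrite eq_le !leNgt; apply/andP; split;
    by apply/negP => /ch.2; rewrite hxy ltxx.
have /choice[tau Htau] (x : R) : exists y, 0 <= x <= 1 -> h y = h S + x * (h T - h S).
  have [/andP[x0 x1]|] := boolP (0 <= x <= 1); last by exists S.
  have [||y _ hy] := @IVT R h S T (h S + x * (h T - h S)) leST.
  - by apply: continuous_subspaceT; exact: ch.1.
  - rewrite min_l// max_r// lerDl mulr_ge0 ?subr_ge0//=.
    by rewrite -lerBrDl ler_piMl// subr_ge0.
  - by exists y.
exists tau; split=> //.
- by apply: hinj; rewrite Htau ?lexx ?ler01// mul0r addr0.
- by apply: hinj; rewrite Htau ?lexx ?ler01// mul1r subrKC.
- move=> x y x0 xy y1; rewrite leNgt; apply/negP => /ch.2.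
  rewrite !Htau ?x0 ?y1 ?(le_trans x0) ?(le_trans xy)//.
  by rewrite ltNge lerD2l ler_wpM2r// subr_ge0.
Qed.

Context (B : completeNormedModType R).

(** Clamping one global dyadic partition to [s, t], instead of subdividing [s, t]
    itself, makes the partitions of [s, u], [u, t] and [s, t] differ only around u.
    Repeated points are harmless, because the functions summed vanish on
    degenerate intervals. *)
Definition node (tau : R -> R) (s t : R) (n k : nat) : R := clamp s t (tau (k%:R / 2 ^+ n)).

Section Nodes.
Context (h tau : R -> R) (ch : clock h) (tau0 : tau 0 = S) (tau1 : tau 1 = T)
  (tau_le : forall x y : R, 0 <= x -> x <= y -> y <= 1 -> tau x <= tau y)
  (h_tau : forall x : R, 0 <= x <= 1 -> h (tau x) = h S + x * (h T - h S)).
Let exp2_gt0 n : 0 < (2 ^+ n : R). Proof. exact: exprn_gt0. Qed.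

Lemma node_first s t n : S <= s -> s <= t -> node tau s t n 0 = s.
Proof. by move=> Ss st; rewrite /node mul0r tau0 /clamp min_l ?(le_trans Ss)// max_l. Qed.

Lemma node_last s t n : s <= t -> t <= T -> node tau s t n (2 ^ n) = t.
Proof.
move=> st tT; rewrite /node natrX divff ?lt0r_neq0// tau1 /clamp min_r// max_r//.
Qed.

Lemma node_itv s t n k : s <= t -> s <= node tau s t n k <= t.
Proof. exact: clamp_itv. Qed.

Let frac_le n k : (k < 2 ^ n)%N -> 0 <= (k%:R / 2 ^+ n : R) <= k.+1%:R / 2 ^+ n.
Proof.
move=> kn; apply/andP; split; first exact: divr_ge0 (ler0n _ _) (ltW (exp2_gt0 n)).
by rewrite ler_pM2r ?invr_gt0// ler_nat.
Qed.

Let frac_le1 n k : (k <= 2 ^ n)%N -> (k%:R / 2 ^+ n : R) <= 1.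
Proof. by move=> kn; rewrite ler_pdivrMr// mul1r -natrX ler_nat. Qed.

Lemma node_le s t n k : (k < 2 ^ n)%N -> node tau s t n k <= node tau s t n k.+1.
Proof.
move=> kn; apply: le_clamp; have /andP[? ?] := frac_le kn.
by apply: tau_le => //; exact: frac_le1.
Qed.

Lemma node_refine s t n k : node tau s t n.+1 (k.*2) = node tau s t n k.
Proof.
by rewrite /node exprS -muln2 natrM [2 * _]mulrC -mulf_div divff ?mulr1// pnatr_eq0.
Qed.

Lemma node_mesh s t n k : s <= t -> (k < 2 ^ n)%N ->
  h (node tau s t n k.+1) - h (node tau s t n k) <= (h T - h S) / 2 ^+ n.
Proof.
move=> st kn; have /andP[k0 kk] := frac_le kn; have k1 := frac_le1 kn.
apply: le_trans (clock_clamp ch st (tau_le k0 kk k1)) _.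
rewrite !h_tau ?k0 ?k1 ?(le_trans k0) ?(le_trans kk)//.
rewrite -natr1; rewrite le_eqVlt; apply/orP; left; apply/eqP.
by field; exact: lt0r_neq0.
Qed.

Lemma node_sum s t n : S <= s -> s <= t -> t <= T ->
  \sum_(0 <= k < 2 ^ n) (h (node tau s t n k.+1) - h (node tau s t n k)) = h t - h s.
Proof.
move=> Ss st tT.
by rewrite (telescope_sumr (fun k => h (node tau s t n k)))// node_first// node_last.
Qed.

(** The excess 2e of the exponent over 1 is shared: one half, applied to the mesh,
    gives a factor geometric in n, and the other half keeps a power of the clock
    length of [s, t] greater than 1. *)
Lemma node_powR_sum e s t n : 0 < e -> S <= s -> s <= t -> t <= T ->
  \sum_(0 <= k < 2 ^ n)
     (h (node tau s t n k.+1) - h (node tau s t n k)) `^ (1 + 2 * e)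
  <= (h T - h S) `^ e * (h t - h s) `^ (1 + e) * (2 `^ (- e)) ^+ n.
Proof.
move=> e0 Ss st tT.
have hst : 0 <= h t - h s by rewrite subr_ge0 clock_le.
apply: (@le_trans _ _ (\sum_(0 <= k < 2 ^ n)
    ((h T - h S) / 2 ^+ n) `^ e * (h t - h s) `^ e *
    (h (node tau s t n k.+1) - h (node tau s t n k)))).
  rewrite !big_mkord; apply: ler_sum => -[k /= kn] _.
  set d := _ - _; have d0 : 0 <= d by rewrite subr_ge0 clock_le// node_le.
  rewrite powR_add ?mulr_ge0 ?(ltW e0)// powRr1// mulrC ler_wpM2r//.
  rewrite mulrDl mul1r powR_add ?(ltW e0)//; apply: ler_pM; rewrite ?powR_ge0//.
    by apply: powR_mono_base => //; [exact: ltW|exact: node_mesh].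
  apply: powR_mono_base => //; first exact: ltW.
  have /andP[? ?] := node_itv n k st; have /andP[? ?] := node_itv n k.+1 st.
  by apply: lerB; exact: clock_le.
have qe : (2 ^+ n)^-1 `^ e = (2 `^ (- e)) ^+ n.
  rewrite -(@powR_mulrn _ (2 `^ (- e)) n (powR_ge0 _ _)).
  rewrite -(@powR_invn _ 2 n (ler0n _ 2)).
  by rewrite -!powRrM !mulNr mulrC.
have q0 : 0 <= (2 ^+ n : R)^-1 by rewrite invr_ge0 exprn_ge0.
rewrite -mulr_sumr node_sum// powRM// ?subr_ge0 ?clock_le// qe.
rewrite powR_add ?ler01 ?(ltW e0)// powRr1//.
by rewrite le_eqVlt; apply/orP; left; apply/eqP; ring.
Qed.

End Nodes.

Definition additive_on (D : R -> R -> B) :=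
  forall s u t, S <= s -> s <= u -> u <= t -> t <= T -> D s t = D s u + D u t.

Let ratio_bounds (e : R) : 0 < e -> 0 <= 2 `^ (- e) < 1.
Proof.
move=> e0; rewrite powR_ge0/= powRN invf_lt1 ?powR_gt0//.
by rewrite -[ltLHS](powRr0 2) /powR pnatr_eq0/= ltr_expR ltr_pM2r// ln_gt0// ltr1n.
Qed.

(** The value on [s, t] is the sum of the values on the pieces of any partition,
    and this sum tends to 0 with the mesh. *)
Lemma additive_small_eq0 theta (D : R -> R -> B) : 1 < theta ->
  additive_on D -> of_order S T theta (fun s _ t => `|D s t|) ->
  forall s t, S <= s -> s <= t -> t <= T -> D s t = 0.
Proof.
move=> th1 addD [h [K [ch K0 DK]]] s t Ss st tT.
have [tau [tau0 tau1 tau_le h_tau]] := dyadic_clock ch.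
pose e := (theta - 1) / 2; have e0 : 0 < e by rewrite divr_gt0// subr_gt0.
have thE : theta = 1 + 2 * e by rewrite /e; field.
have /andP[r0 r1] := ratio_bounds e0.
apply/eqP; rewrite -normr_le0.
apply: (@geometric_bound_le0 _ _
  (K * ((h T - h S) `^ e * (h t - h s) `^ (1 + e))) (2 `^ (- e))) => // n.
have DE m : (m <= 2 ^ n)%N ->
    D s (node tau s t n m) = \sum_(0 <= k < m) D (node tau s t n k) (node tau s t n k.+1).
  elim: m => [_|m IH mn]; last first.
    rewrite big_nat_recr//= -IH ?(ltnW mn)//.
    have /andP[? ?] := node_itv tau n m st; have /andP[? ?] := node_itv tau n m.+1 st.
    by apply: addD => //; [exact: node_le|exact: le_trans tT].
  rewrite big_geq// (node_first tau0)//; have := @addD s s s Ss (lexx s) (lexx s).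
  by move=> /(_ (le_trans st tT)) /eqP; rewrite -subr_eq subrr => /eqP <-.
rewrite -{1}(node_last tau1 n st tT) DE//.
apply: le_trans (ler_norm_sum _ _ _) _; rewrite -mulrA.
apply: le_trans _ (ler_wpM2l K0 (node_powR_sum ch tau0 tau1 tau_le h_tau n e0 Ss st tT)).
rewrite mulr_sumr !big_mkord; apply: ler_sum => -[k /= kn] _.
have /andP[? ?] := node_itv tau n k st; have /andP[? ?] := node_itv tau n k.+1 st.
rewrite -thE; apply: (DK _ (node tau s t n k)) => //.
- exact: le_trans Ss _.
- exact: node_le.
- exact: le_trans tT.
Qed.

(** The sewing lemma.  Refining the dyadic partition once changes the Riemann sum
    of A by defects of A on the pieces, so the sums converge geometrically.
    The limit is additive because inserting u in a partition again costs only
    such defects.  The exponent theta' is smaller than theta, which is the price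
    of the geometric factor in [node_powR_sum]; only theta' > 1 matters below. *)
Lemma additive_sewing theta (A : R -> R -> B) : 1 < theta ->
  of_order S T theta (fun s u t => `|A s t - A s u - A u t|) ->
  exists (I : R -> R -> B) (theta' : R), [/\ 1 < theta', additive_on I &
    of_order S T theta' (fun s _ t => `|I s t - A s t|)].
Proof.
move=> th1 [h [K [ch K0 AK]]].
have [tau [tau0 tau1 tau_le h_tau]] := dyadic_clock ch.
pose e := (theta - 1) / 2; have e0 : 0 < e by rewrite divr_gt0// subr_gt0.
have thE : theta = 1 + 2 * e by rewrite /e; field.
have /andP[r0 r1] := ratio_bounds e0.
pose L := (h T - h S) `^ e; pose r := 2 `^ (- e).
have L0 : 0 <= L by exact: powR_ge0.
have A0 u : S <= u -> u <= T -> A u u = 0.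
  move=> Su uT; have := AK u u u Su (lexx u) (lexx u) uT.
  rewrite !subrr sub0r normrN powR0 ?mulr0 ?normr_le0; last by rewrite gt_eqF//; lra.
  by move/eqP.
pose I_ n s t := \sum_(0 <= k < 2 ^ n) A (node tau s t n k) (node tau s t n k.+1).
have sumK (F : nat -> R -> R -> B) n s t : S <= s -> s <= t -> t <= T ->
    (forall k, (k < 2 ^ n)%N -> `|F k s t| <=
       K * (h (node tau s t n k.+1) - h (node tau s t n k)) `^ theta) ->
    `|\sum_(0 <= k < 2 ^ n) F k s t| <= K * L * (h t - h s) `^ (1 + e) * r ^+ n.
  move=> Ss st tT FK; apply: le_trans (ler_norm_sum _ _ _) _; rewrite -!mulrA.
  have := ler_wpM2l K0 (node_powR_sum ch tau0 tau1 tau_le h_tau n e0 Ss st tT).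
  rewrite -!mulrA; apply: le_trans; rewrite mulr_sumr !big_mkord.
  by apply: ler_sum => -[k /= kn] _; rewrite -thE; exact: FK.
have step s t n : S <= s -> s <= t -> t <= T ->
    `|I_ n.+1 s t - I_ n s t| <= K * L * (h t - h s) `^ (1 + e) * r ^+ n.
  move=> Ss st tT.
  (* pair the pieces of the refined partition inside each coarse piece *)
  have double (G : nat -> B) m :
      \sum_(0 <= k < m.*2) G k = \sum_(0 <= k < m) (G k.*2 + G k.*2.+1).
    elim: m => [|m IH]; first by rewrite !big_geq.
    by rewrite doubleS !big_nat_recr//= IH addrA.
  rewrite /I_ expnS mul2n double -sumrB -normrN -sumrN.
  under eq_bigr do rewrite opprB -!doubleS !node_refine opprD addrA.
  apply: (sumK (fun k s t => _)) => // k kn.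
  have kn2 : (k.*2.+1 < 2 ^ n.+1)%N by rewrite expnS mul2n -doubleS leq_double.
  have /andP[? ?] := node_itv tau n k st; have /andP[? ?] := node_itv tau n k.+1 st.
  apply: AK.
  - exact: le_trans Ss _.
  - by rewrite -(node_refine tau s t n k); apply: node_le => //; exact: ltnW.
  - by rewrite -(node_refine tau s t n k.+1) doubleS; exact: node_le.
  - exact: le_trans tT.
have /choice[I HI] (st : R * R) : exists l, S <= st.1 -> st.1 <= st.2 -> st.2 <= T ->
    (fun n => I_ n st.1 st.2) @ \oo --> l /\
    `|l - A st.1 st.2| <= K * L * (h st.2 - h st.1) `^ (1 + e) / (1 - r).
  case: st => s t /=.
  have [[Ss [st tT]]|] := pselect (S <= s /\ s <= t /\ t <= T); last by exists 0; tauto.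
  have C0 : 0 <= K * L * (h t - h s) `^ (1 + e) by rewrite !mulr_ge0 ?powR_ge0.
  have [l [cl Hl]] := geometric_increments_cvg C0 r0 r1 (fun n => step s t n Ss st tT).
  exists l => _ _ _; split=> //; move: Hl.
  by rewrite {1}/I_ expn0 big_nat1 node_first// -[1%N](expn0 2) node_last.
exists (fun s t => I (s, t)), (1 + e); split; first by rewrite ltrDl.
- move=> s u t Ss su ut tT.
  have st := le_trans su ut; have Su := le_trans Ss su; have uT := le_trans ut tT.
  have [c1 _] := HI (s, u) Ss su uT; have [c2 _] := HI (u, t) Su ut tT.
  have [c3 _] := HI (s, t) Ss st tT; rewrite /= in c1 c2 c3.
  have c : (fun n => `|I_ n s t - I_ n s u - I_ n u t|) @ \oo -->
      `|I (s, t) - I (s, u) - I (u, t)|.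
    by apply: cvg_norm; apply: cvgB => //; exact: cvgB.
  suff : I (s, t) - I (s, u) - I (u, t) = 0.
    by move/eqP; rewrite subr_eq0 subr_eq addrC => /eqP.
  apply/eqP; rewrite -normr_le0 -(cvg_lim (@Rhausdorff R) c).
  have cg := cvg_geometric (K * L * (h t - h s) `^ (1 + e))
    (ltac:(by rewrite ger0_norm) : `|r| < 1).
  rewrite -(cvg_lim (@Rhausdorff R) cg); apply: ler_lim; [exact: cvgP c|exact: cvgP cg|].
  apply: nearW => n; rewrite /I_ -!sumrB.
  apply: (sumK (fun k _ _ => A (node tau s t n k) (node tau s t n k.+1) -
    A (node tau s u n k) (node tau s u n k.+1) -
    A (node tau u t n k) (node tau u t n k.+1)) n s t Ss st tT) => k kn.
  have /andP[Sa aT] := node_itv tau n k st; have /andP[Sb bT] := node_itv tau n k.+1 st.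
  have : node tau s t n k <= node tau s t n k.+1 by exact: node_le.
  move: Sa aT Sb bT.
  have nl m : node tau s u n m = Num.min (node tau s t n m) u by exact: clamp_left.
  have nr m : node tau u t n m = Num.max (node tau s t n m) u by exact: clamp_right.
  rewrite !nl !nr; set a := node _ s t n k; set b := node _ s t n k.+1.
  move=> Sa aT Sb bT ab.
  (* only the piece that has u in its interior contributes a defect *)
  have rhs0 : 0 <= K * (h b - h a) `^ theta by rewrite mulr_ge0// powR_ge0.
  have /orP[ua|au] := le_total u a.
    have ub := le_trans ua ab.
    by rewrite (min_r ua) (min_r ub) (max_l ua) (max_l ub) (A0 _ Su uT) subr0 subrr normr0.
  have /orP[bu|ub] := le_total b u.
    by rewrite (min_l au) (min_l bu) (max_r au) (max_r bu) (A0 _ Su uT) subr0 subrr normr0.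
  rewrite (min_l au) (min_r ub) (max_r au) (max_l ub).
  by apply: AK => //; [exact: le_trans Ss _|exact: le_trans tT].
- exists h, (K * L / (1 - r)); split=> //.
    by rewrite !mulr_ge0// invr_ge0 subr_ge0 ltW.
  move=> s u t Ss su ut tT; have [_] := HI (s, t) Ss (le_trans su ut) tT.
  by rewrite /= mulrAC.
Qed.

End AdditiveSewing.

(** * The truncated tensor algebra *)

Section TruncatedTensorAlgebra.
Context {R : realType} {V : completeNormedModType R} {E : tensor_data V}.
Context (admE : admissible_tensor_powers E).

Lemma tpow_castD m n (e : m = n) (x y : tpow E m) :
  tpow_cast e (x + y) = tpow_cast e x + tpow_cast e y.
Proof. by case: n / e. Qed.

Lemma norm_tpow_cast m n (e : m = n) (x : tpow E m) : `|tpow_cast e x| = `|x|.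
Proof. by case: n / e. Qed.

(** The product read in degree n, and 0 when the degrees do not add up to n.  This
    hides the casts between V^(j+l) and V^n, and lets the levels of a product be
    written as sums over all pairs of degrees. *)
Definition tmul_to n j l (x : tpow E j) (y : tpow E l) : tpow E n :=
  if @eqP _ (j + l)%N n is ReflectT e then tpow_cast e (tmul E j l x y) else 0.

Lemma tmul_toE n j l (e : (j + l)%N = n) x y :
  tmul_to n x y = tpow_cast e (tmul E j l x y).
Proof. by rewrite /tmul_to; case: eqP => // e'; rewrite (eq_irrelevance e' e). Qed.

Lemma tmul_to_eq0 n j l (x : tpow E j) (y : tpow E l) :
  (j + l)%N != n -> tmul_to n x y = 0.
Proof. by rewrite /tmul_to; case: eqP. Qed.

Lemma tmul_toDl n j l (x x' : tpow E j) (y : tpow E l) :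
  tmul_to n (x + x') y = tmul_to n x y + tmul_to n x' y.
Proof.
by rewrite /tmul_to; case: eqP => e; rewrite ?addr0// linearDl tpow_castD.
Qed.

Lemma tmul_toDr n j l (x : tpow E j) (y y' : tpow E l) :
  tmul_to n x (y + y') = tmul_to n x y + tmul_to n x y'.
Proof.
by rewrite /tmul_to; case: eqP => e; rewrite ?addr0// linearDr tpow_castD.
Qed.

Lemma tmul_to0l n j l (y : tpow E l) : tmul_to n (0 : tpow E j) y = 0.
Proof. by apply: (addIr (tmul_to n (0 : tpow E j) y)); rewrite -tmul_toDl !add0r. Qed.

Lemma tmul_to0r n j l (x : tpow E j) : tmul_to n x (0 : tpow E l) = 0.
Proof. by apply: (addIr (tmul_to n x (0 : tpow E l))); rewrite -tmul_toDr !add0r. Qed.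

Lemma tmul_to_suml n j l I (r : seq I) (P : pred I) (F : I -> tpow E j) (y : tpow E l) :
  tmul_to n (\sum_(i <- r | P i) F i) y = \sum_(i <- r | P i) tmul_to n (F i) y.
Proof.
by apply: (big_morph (fun x => tmul_to n x y)) => [? ?|]; rewrite ?tmul_toDl ?tmul_to0l.
Qed.

Lemma tmul_to_sumr n j l I (r : seq I) (P : pred I) (x : tpow E j) (F : I -> tpow E l) :
  tmul_to n x (\sum_(i <- r | P i) F i) = \sum_(i <- r | P i) tmul_to n x (F i).
Proof.
by apply: (big_morph (fun y => tmul_to n x y)) => [? ?|]; rewrite ?tmul_toDr ?tmul_to0r.
Qed.

Lemma norm_tmul_to n j l (x : tpow E j) (y : tpow E l) :
  `|tmul_to n x y| <= `|x| * `|y|.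
Proof.
rewrite /tmul_to; case: eqP => e; last by rewrite normr0 mulr_ge0.
by rewrite norm_tpow_cast; exact: ts_mul_norm.
Qed.

Lemma tmul_to1l n (y : tpow E n) : tmul_to n (tinj0 E 1) y = y.
Proof. by rewrite (tmul_toE (erefl : (0 + n)%N = n)) /= ts_mul0l// scale1r. Qed.

Lemma tmul_to1r n (x : tpow E n) : tmul_to n x (tinj0 E 1) = x.
Proof. by rewrite (tmul_toE (addn0 n)) ts_mul0r// scale1r. Qed.

(** Both sums have at most one nonzero term, at i = j + l and at i = l + m. *)
Lemma tmul_toA N n j l m (x : tpow E j) (y : tpow E l) (z : tpow E m) : (n <= N)%N ->
  \sum_(i < N.+1) tmul_to n (tmul_to i x y) z =
  \sum_(i < N.+1) tmul_to n x (tmul_to i y z).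
Proof.
move=> nN; have [nE|nE] := eqVneq (j + l + m)%N n; last first.
  rewrite !big1// => i _.
    have [iE|/tmul_to_eq0->] := eqVneq (l + m)%N i; last exact: tmul_to0r.
    by rewrite tmul_to_eq0// -iE addnA.
  have [iE|/tmul_to_eq0->] := eqVneq (j + l)%N i; last exact: tmul_to0l.
  by rewrite tmul_to_eq0// -iE.
subst n.
have jl : (j + l < N.+1)%N by rewrite ltnS (leq_trans _ nN)// leq_addr.
have lm : (l + m < N.+1)%N by rewrite ltnS (leq_trans _ nN)// -addnA leq_addl.
rewrite (bigD1 (Ordinal jl))// big1 ?addr0; last first.
  move=> i ne; rewrite (@tmul_to_eq0 i) ?tmul_to0l//.
  by apply: contraNneq ne => e; apply/eqP/val_inj.
rewrite [RHS](bigD1 (Ordinal lm))// big1 ?addr0; last first.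
  move=> i ne; rewrite (@tmul_to_eq0 i) ?tmul_to0r//.
  by apply: contraNneq ne => e; apply/eqP/val_inj.
rewrite /= !(tmul_toE erefl) /= (tmul_toE (addnA j l m)).
by rewrite ts_mulA.
Qed.

Context {k : nat}.
Implicit Types a b c : ttensor E k.

Lemma ttmulE a b (i : 'I_k.+1) :
  ttmul a b i = \sum_(j < k.+1) \sum_(l < k.+1) tmul_to i (a j) (b l).
Proof.
have inner (j : 'I_k.+1) (y : forall l : 'I_k.+1, tpow E l) (ji : (j <= i)%N) :
    \sum_(l < k.+1) tmul_to i (a j) (y l) =
    tmul_to i (a j) (y (Ordinal (sub_lt i j))).
  rewrite (bigD1 (Ordinal (sub_lt i j)))//= big1 ?addr0// => l ne.
  apply: tmul_to_eq0; apply: contraNneq ne => e; apply/eqP/val_inj => /=.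
  by rewrite -e addKn.
transitivity (\sum_(j < k.+1 | (j < i.+1)%N) \sum_(l < k.+1) tmul_to i (a j) (b l)).
  rewrite (big_ord_narrow (ltn_ord i)) /ttmul; apply: eq_bigr => j _.
  rewrite (@inner (widen_ord (ltn_ord i) j) b (leq_ord j)).
  apply/esym; exact: (@tmul_toE i j (i - j) (subnKC (leq_ord j))).
rewrite [RHS](bigID (fun j : 'I_k.+1 => (j < i.+1)%N))/= [X in _ + X]big1 ?addr0//.
move=> j; rewrite ltnS -ltnNge => ij; rewrite big1// => l _; apply: tmul_to_eq0.
by rewrite neq_ltn (leq_trans ij) ?orbT// leq_addr.
Qed.

Lemma ttmulA a b c : ttmul (ttmul a b) c = ttmul a (ttmul b c).
Proof.
apply: functional_extensionality_dep => i; rewrite !ttmulE.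
transitivity (\sum_(l < k.+1) \sum_(m < k.+1) \sum_(n < k.+1) \sum_(j < k.+1)
    tmul_to i (tmul_to j (a l) (b m)) (c n)).
  transitivity (\sum_(j < k.+1) \sum_(n < k.+1) \sum_(l < k.+1) \sum_(m < k.+1)
      tmul_to i (tmul_to j (a l) (b m)) (c n)).
    apply: eq_bigr => j _; apply: eq_bigr => n _; rewrite ttmulE tmul_to_suml.
    by apply: eq_bigr => l _; rewrite tmul_to_suml.
  under eq_bigr do rewrite exchange_big/=.
  rewrite exchange_big/=; apply: eq_bigr => l _.
  under eq_bigr do rewrite exchange_big/=.
  rewrite exchange_big/=; apply: eq_bigr => m _.
  by rewrite exchange_big.
apply: eq_bigr => l _.
transitivity (\sum_(j < k.+1) \sum_(m < k.+1) \sum_(n < k.+1)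
    tmul_to i (a l) (tmul_to j (b m) (c n))); last first.
  apply: eq_bigr => j _; rewrite ttmulE tmul_to_sumr.
  by apply: eq_bigr => m _; rewrite tmul_to_sumr.
rewrite [RHS]exchange_big/=; apply: eq_bigr => m _.
rewrite [RHS]exchange_big/=; apply: eq_bigr => n _.
by apply: tmul_toA; exact: leq_ord.
Qed.

(** The part of level i of a product that involves only lower levels of the
    factors, when the latter start with 1; see [ttmul_level] and [eq_cross]. *)
Definition cross (i : 'I_k.+1) a b : tpow E i :=
  \sum_(j < k.+1 | (0 < j)%N) \sum_(l < k.+1 | (0 < l)%N) tmul_to i (a j) (b l).

Lemma ttmul0 a b : a ord0 = tinj0 E 1 -> b ord0 = tinj0 E 1 ->
  ttmul a b ord0 = tinj0 E 1.
Proof.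
move=> a0 b0; rewrite ttmulE (bigD1 ord0)//= (bigD1 ord0)//= a0 b0.
rewrite tmul_to1l !big1 ?addr0// => [j j0|l l0].
  rewrite big1// => l _; apply: tmul_to_eq0.
  by rewrite addn_eq0; apply: contra j0 => /andP[/eqP j0 _]; apply/eqP/val_inj.
by apply: tmul_to_eq0; apply: contra l0 => /eqP l0; apply/eqP/val_inj.
Qed.

Lemma ttmul_level a b (i : 'I_k.+1) : (0 < i)%N ->
  a ord0 = tinj0 E 1 -> b ord0 = tinj0 E 1 ->
  ttmul a b i = a i + b i + cross i a b.
Proof.
move=> i0 a0 b0; rewrite ttmulE.
have pos (j : 'I_k.+1) : (j != ord0) = (0 < j)%N by rewrite lt0n.
rewrite (bigD1 ord0)//= [X in X + _ = _](_ : _ = b i); last first.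
  rewrite (bigD1 i)//= a0 tmul_to1l big1 ?addr0// => l li.
  by apply: tmul_to_eq0; rewrite add0n.
rewrite addrAC addrC; congr (_ + _); rewrite /cross (eq_bigl _ _ pos).
rewrite (_ : a i = \sum_(j < k.+1 | (0 < j)%N) tmul_to i (a j) (b ord0)).
  rewrite -big_split/=; apply: eq_bigr => j _.
  by rewrite (bigD1 ord0)//=; under eq_bigl do rewrite pos.
rewrite (bigD1 i)//= b0 tmul_to1r big1 ?addr0// => j /andP[_ ji].
by apply: tmul_to_eq0; rewrite addn0.
Qed.

Lemma eq_cross (i : 'I_k.+1) a a' b b' :
  (forall j : 'I_k.+1, (0 < j < i)%N -> a j = a' j) ->
  (forall j : 'I_k.+1, (0 < j < i)%N -> b j = b' j) ->
  cross i a b = cross i a' b'.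
Proof.
move=> aa bb; apply: eq_bigr => j j0; apply: eq_bigr => l l0.
have [e|ne] := eqVneq (j + l)%N i; last by rewrite !tmul_to_eq0.
rewrite aa ?bb//.
  by rewrite l0 -e -{1}[nat_of_ord l]add0n ltn_add2r.
by rewrite j0 -e -{1}[nat_of_ord j]addn0 ltn_add2l.
Qed.

Lemma crossDl (i : 'I_k.+1) a a' c b :
  (forall j : 'I_k.+1, (0 < j)%N -> c j = a j + a' j) ->
  cross i c b = cross i a b + cross i a' b.
Proof.
move=> cE; rewrite -big_split; apply: eq_bigr => j j0; rewrite -big_split.
by apply: eq_bigr => l _; rewrite cE// tmul_toDl.
Qed.

Lemma crossDr (i : 'I_k.+1) a b b' c :
  (forall j : 'I_k.+1, (0 < j)%N -> c j = b j + b' j) ->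
  cross i a c = cross i a b + cross i a b'.
Proof.
move=> cE; rewrite -big_split; apply: eq_bigr => j _; rewrite -big_split.
by apply: eq_bigr => l l0; rewrite cE// tmul_toDr.
Qed.

Lemma norm_cross (i : 'I_k.+1) a b : `|cross i a b| <=
  \sum_(j < k.+1 | (0 < j)%N) \sum_(l < k.+1 | (0 < l)%N) `|a j| * `|b l|.
Proof.
apply: le_trans (ler_norm_sum _ _ _) _; apply: ler_sum => j _.
apply: le_trans (ler_norm_sum _ _ _) _; apply: ler_sum => l _.
exact: norm_tmul_to.
Qed.

(** Level i of associativity, after cancelling the terms linear in level i.  The
    assumptions on ab and bc stop below i, so that the identity is available when
    Chen's identity has been established below level i only. *)
Lemma cross_cocycle (i : 'I_k.+1) a b c ab bc : (0 < i)%N ->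
  a ord0 = tinj0 E 1 -> b ord0 = tinj0 E 1 -> c ord0 = tinj0 E 1 ->
  (forall j : 'I_k.+1, (0 < j < i)%N -> ab j = ttmul a b j) ->
  (forall j : 'I_k.+1, (0 < j < i)%N -> bc j = ttmul b c j) ->
  cross i a b + cross i ab c = cross i b c + cross i a bc.
Proof.
move=> i0 a0 b0 c0 abE bcE.
rewrite (eq_cross abE (fun _ _ => erefl)) (eq_cross (fun _ _ => erefl) bcE).
have e : ttmul (ttmul a b) c i = ttmul a (ttmul b c) i by rewrite ttmulA.
rewrite (ttmul_level i0 (ttmul0 a0 b0) c0) (ttmul_level i0 a0 (ttmul0 b0 c0)) in e.
rewrite (ttmul_level i0 a0 b0) (ttmul_level i0 b0 c0) in e.
apply: (addrI (a i + b i + c i)).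
by rewrite addrA (addrAC (a i + b i)) e !addrA.
Qed.

End TruncatedTensorAlgebra.

(** * Multiplicative functionals: continuity *)

Section MultiplicativeContinuity.
Context {R : realType} {V : completeNormedModType R} {E : tensor_data V}.
Context (admE : admissible_tensor_powers E) (S T : R) {k : nat}.
Local Notation path := (R * R -> ttensor E k).
Implicit Types X Y Z : path.

Definition chen_at X (i : 'I_k.+1) :=
  forall s u t, S <= s -> s <= u -> u <= t -> t <= T ->
  ttmul (X (s, u)) (X (u, t)) i = X (s, t) i.

Lemma ttensor_cvg (F : set_system (R * R)) (FF : Filter F) X (x : ttensor E k) :
  (forall i, (fun st => X st i) @ F --> x i) -> X @ F --> x.
Proof.
move=> cX; apply/cvg_sup => i A.
rewrite nbhsE => -[B [[U oU <-] Ux] BA].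
by apply: (filterS BA); apply: cX; apply: open_nbhs_nbhs; split.
Qed.

Lemma level_le_sum X st (i : 'I_k.+1) : (0 < i)%N ->
  `|X st i| <= \sum_(j < k.+1 | (0 < j)%N) `|X st j|.
Proof. by move=> i0; rewrite (bigD1 i)//= lerDl sumr_ge0. Qed.

(** By Chen's identity, enlarging the interval at one end changes X by O(small^a).
    Two nearby intervals [s, t] and [s', t'] are compared through their hull,
    since an interval such as [s, t'] may fail to be in the triangle. *)
Lemma chen_continuous a X : 0 < a -> level0_one S T X -> (forall i, chen_at X i) ->
  (forall i : 'I_k.+1, (0 < i)%N -> of_order S T a (fun s _ t => `|X (s, t) i|)) ->
  {within triangle S T, continuous X}.
Proof.
move=> a0 X0 chX Xa; have a0' := ltW a0.
have [h [K [ch K0 XK]]] : of_order S T a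
    (fun s _ t => \sum_(j < k.+1 | (0 < j)%N) `|X (s, t) j|).
  exact: of_order_sum.
pose M := K * (h T - h S) `^ a.
have M0 : 0 <= M by rewrite mulr_ge0// powR_ge0.
pose C := (1 + M) * K.
have C0 : 0 <= C by rewrite mulr_ge0// addr_ge0.
have XM s t : S <= s -> s <= t -> t <= T ->
    \sum_(j < k.+1 | (0 < j)%N) `|X (s, t) j| <= M.
  move=> Ss st tT; apply: le_trans (XK s s t Ss (lexx s) st tT) _.
  apply: ler_wpM2l => //; apply: powR_mono_base => //.
    by rewrite subr_ge0 clock_le.
  by apply: lerB; exact: clock_le.
have crossM s u t (i : 'I_k.+1) : S <= s -> s <= u -> u <= t -> t <= T ->
    `|cross i (X (s, u)) (X (u, t))| <=
    (\sum_(j < k.+1 | (0 < j)%N) `|X (s, u) j|) * \sum_(j < k.+1 | (0 < j)%N) `|X (u, t) j|.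
  move=> Ss su ut tT; apply: le_trans (norm_cross admE _ _ _) _.
  by rewrite mulr_suml; apply: ler_sum => j _; rewrite mulr_sumr.
have right s u t (i : 'I_k.+1) : (0 < i)%N -> S <= s -> s <= u -> u <= t -> t <= T ->
    `|X (s, t) i - X (s, u) i| <= C * (h t - h u) `^ a.
  move=> i0 Ss su ut tT; have Su := le_trans Ss su; have uT := le_trans ut tT.
  rewrite -(chX i s u t)// ttmul_level//; do ?by apply: X0; split.
  rewrite addrAC (addrC (X (s, u) i)) addrK; apply: le_trans (ler_normD _ _) _.
  rewrite /C -mulrA mulrDl mul1r; have HK := XK u u t Su (lexx u) ut tT.
  apply: lerD; first exact: le_trans (level_le_sum _ _ i0) HK.
  apply: le_trans (crossM _ _ _ _ Ss su ut tT) _; apply: ler_pM => //.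
  - exact: sumr_ge0.
  - exact: sumr_ge0.
  - exact: XM.
have left s u t (i : 'I_k.+1) : (0 < i)%N -> S <= s -> s <= u -> u <= t -> t <= T ->
    `|X (s, t) i - X (u, t) i| <= C * (h u - h s) `^ a.
  move=> i0 Ss su ut tT; have Su := le_trans Ss su; have uT := le_trans ut tT.
  rewrite -(chX i s u t)// ttmul_level//; do ?by apply: X0; split.
  rewrite addrAC addrK; apply: le_trans (ler_normD _ _) _.
  rewrite /C -mulrA mulrDl mul1r; have HK := XK s s u Ss (lexx s) su uT.
  apply: lerD; first exact: le_trans (level_le_sum _ _ i0) HK.
  apply: le_trans (crossM _ _ _ _ Ss su ut tT) _; rewrite mulrC; apply: ler_pM => //.
  - exact: sumr_ge0.
  - exact: sumr_ge0.
  - exact: XM.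
have mod s t s' t' (i : 'I_k.+1) : (0 < i)%N -> triangle S T (s, t) -> triangle S T (s', t') ->
    `|X (s, t) i - X (s', t') i| <=
    2 * C * (`|h s - h s'| `^ a + `|h t - h t'| `^ a).
  move=> i0.
  have half p q s0 t0 s1 t1 : p = Num.min s0 s1 -> q = Num.max t0 t1 ->
      triangle S T (s0, t0) -> triangle S T (s1, t1) ->
      `|X (p, q) i - X (s0, t0) i| <= C * (`|h s0 - h s1| `^ a + `|h t0 - h t1| `^ a).
    move=> pE qE [/= Ss0 [st0 t0T]] [/= Ss1 [st1 t1T]].
    have ps0 : p <= s0 by rewrite pE ge_min lexx.
    have t0q : t0 <= q by rewrite qE le_max lexx.
    have Sp : S <= p by rewrite pE le_min Ss0.
    have qT : q <= T by rewrite qE ge_max t0T.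
    have -> : X (p, q) i - X (s0, t0) i =
        (X (p, q) i - X (p, t0) i) + (X (p, t0) i - X (s0, t0) i).
      by rewrite addrA subrK.
    apply: le_trans (ler_normD _ _) _; rewrite addrC mulrDr; apply: lerD.
      apply: le_trans (left _ _ _ _ i0 Sp ps0 st0 t0T) _; apply: ler_wpM2l => //.
      apply: powR_mono_base => //; first by rewrite subr_ge0 clock_le.
      rewrite pE minEle; case: ifP => _; first by rewrite subrr.
      exact: ler_norm.
    apply: le_trans (right _ _ _ _ i0 Sp (le_trans ps0 st0) t0q qT) _; apply: ler_wpM2l => //.
    apply: powR_mono_base => //; first by rewrite subr_ge0 clock_le.
    rewrite qE maxEle; case: ifP => _; last by rewrite subrr.
    by rewrite distrC; exact: ler_norm.
  move=> tr0 tr1; have H0 := half _ _ _ _ _ _ erefl erefl tr0 tr1.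
  have H1 := half _ _ _ _ _ _ erefl erefl tr1 tr0.
  rewrite minC maxC (distrC (h s')) (distrC (h t')) in H1.
  rewrite mulrDl mul1r mulrDl.
  rewrite -(subrK (X (Num.min s s', Num.max t t') i) (X (s, t) i)) -addrA.
  by apply: le_trans (ler_normD _ _) _; rewrite distrC; exact: lerD.
apply/subspace_continuousP => -[s t] tr; apply: ttensor_cvg => i.
have [i0|] := boolP (0 < i)%N; last first.
  rewrite -eqn0Ngt => /eqP i0; have -> : i = ord0 by exact/val_inj.
  apply: (@cvg_near_cst _ (tpow E 0)).
  apply: (filterS _ (withinT (triangle S T) (nbhs_filter (s, t)))) => st trst.
  exact: etrans (X0 _ trst) (esym (X0 _ tr)).
apply/cvgrPdist_lt => eps eps0.
pose d := (eps / (4 * C + 1)) `^ a^-1.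
have C1 : 0 < 4 * C + 1 by rewrite ltr_wpDl// mulr_ge0.
have d0 : 0 < d by rewrite powR_gt0// divr_gt0.
have da : d `^ a = eps / (4 * C + 1).
  by rewrite -powRrM mulVf ?gt_eqF// powRr1// ltW// divr_gt0.
have hs : \forall x \near (s, t), `|h s - h x.1| < d.
  have : (fun x : R * R => h x.1) @ (s, t) --> h s.
    by apply: (cvg_comp _ _ cvg_fst); exact: ch.1.
  by move=> /cvgrPdist_lt; exact.
have ht : \forall x \near (s, t), `|h t - h x.2| < d.
  have : (fun x : R * R => h x.2) @ (s, t) --> h t.
    by apply: (cvg_comp _ _ cvg_snd); exact: ch.1.
  by move=> /cvgrPdist_lt; exact.
suff : \forall x \near (s, t), triangle S T x -> `|X (s, t) i - X x i| < eps by exact.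
near=> x; move=> trx; have xE : x = (x.1, x.2) by case: (x).
rewrite xE; rewrite xE in trx.
apply: le_lt_trans (mod _ _ _ _ _ i0 tr trx) _.
have bd y : 0 <= y -> y < d -> y `^ a <= eps / (4 * C + 1).
  by move=> y0 yd; rewrite -da powR_mono_base// ltW.
have b1 : `|h s - h x.1| `^ a <= eps / (4 * C + 1).
  by apply: bd => //; near: x.
have b2 : `|h t - h x.2| `^ a <= eps / (4 * C + 1).
  by apply: bd => //; near: x.
apply: le_lt_trans (_ : _ <= 2 * C * (2 * (eps / (4 * C + 1)))) _.
  by apply: ler_wpM2l; [exact: mulr_ge0|lra].
rewrite (_ : 2 * C * (2 * (eps / (4 * C + 1))) = eps * (4 * C) / (4 * C + 1));
  last by field; rewrite gt_eqF.
by rewrite ltr_pdivrMr// ltr_pM2l// ltrDl.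
Unshelve. all: by end_near. Qed.

End MultiplicativeContinuity.

(** * Closeness, and uniqueness of multiplicative functionals *)

Section RoughSewing.
Context {R : realType} {V : completeNormedModType R} {E : tensor_data V}.
Context (admE : admissible_tensor_powers E) (S T : R) {k : nat}.
Local Notation path := (R * R -> ttensor E k).
Implicit Types X Y Z : path.

Definition close X Y := exists2 theta, 1 < theta &
  forall i : 'I_k.+1, (0 < i)%N ->
    of_order S T theta (fun s _ t => `|X (s, t) i - Y (s, t) i|).

(** The condition on the defect in the definition of the almost multiplicative
    maps, with the control and the exponent left free. *)
Definition almost_chen X := exists2 theta, 1 < theta &
  forall i : 'I_k.+1, (0 < i)%N ->
    of_order S T theta (fun s u t => `|ttmul (X (s, u)) (X (u, t)) i - X (s, t) i|).

Definition level_order (a : R) X := forall i : 'I_k.+1, (0 < i)%N ->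
  of_order S T a (fun s _ t => `|X (s, t) i|).

Lemma close_refl X : close X X.
Proof.
exists 2; first by rewrite ltr1n.
by move=> i _; apply: of_order_le (of_order0 S T 2) _ => *; rewrite subrr normr0.
Qed.

Lemma close_sym X Y : close X Y -> close Y X.
Proof.
move=> [th th1 H]; exists th => // i i0.
by apply: of_order_le (H i i0) _ => *; rewrite distrC.
Qed.

Lemma close_trans X Y Z : close X Y -> close Y Z -> close X Z.
Proof.
move=> [t1 t11 H1] [t2 t21 H2]; exists (Num.min t1 t2); first by rewrite lt_min t11.
move=> i i0; have m0 : 0 <= Num.min t1 t2 by rewrite le_min !ltW// (lt_trans ltr01).
have B1 := of_order_weaken m0 (_ : Num.min t1 t2 <= t1) (H1 i i0).
have B2 := of_order_weaken m0 (_ : Num.min t1 t2 <= t2) (H2 i i0).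
apply: of_order_le (of_orderD m0 (B1 _) (B2 _)) _ => [||s u t *].
- by rewrite ge_min lexx.
- by rewrite ge_min lexx orbT.
- exact: ler_distD.
Qed.

Lemma level_order_weaken a b X : 0 <= a -> a <= b -> level_order b X -> level_order a X.
Proof. by move=> a0 ab Xb i i0; apply: of_order_weaken (Xb i i0). Qed.

(** The exponent of closeness exceeds 1, so it never spoils a bound of order a for
    a at most 1. *)
Lemma close_of_order a X Y (i : 'I_k.+1) : (0 < i)%N -> 0 <= a <= 1 -> close X Y ->
  of_order S T a (fun s _ t => `|Y (s, t) i|) ->
  of_order S T a (fun s _ t => `|X (s, t) i|).
Proof.
move=> i0 /andP[a0 a1] [th th1 H] Ya.
have B := of_order_weaken a0 (le_trans a1 (ltW th1)) (H i i0).
apply: of_order_le (of_orderD a0 B Ya) _ => s u t *.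
by rewrite -[X in `|X| <= _](subrK (Y (s, t) i)) ler_normD.
Qed.

Lemma of_order_cross a b X Y (i : 'I_k.+1) : 0 <= a -> 0 <= b ->
  level_order a X -> level_order b Y ->
  of_order S T (a + b) (fun s u t => `|cross i (X (s, u)) (Y (u, t))|).
Proof.
move=> a0 b0 Xa Yb.
apply: of_order_le (_ : of_order S T (a + b) (fun s u t =>
  \sum_(j < k.+1 | (0 < j)%N) \sum_(l < k.+1 | (0 < l)%N)
    `|X (s, u) j| * `|Y (u, t) l|)) _; last by move=> *; exact: norm_cross.
apply: of_order_sum => [|j j0]; first exact: addr_ge0.
apply: of_order_sum => [|l l0]; first exact: addr_ge0.
apply: of_orderM => //.
- exact: (of_order_left (F := fun s t => `|X (s, t) j|)) (Xa j j0).
- exact: (of_order_right (F := fun s t => `|Y (s, t) l|)) (Yb l l0).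
Qed.

Lemma level0_triangle X s t : level0_one S T X -> S <= s -> s <= t -> t <= T ->
  X (s, t) ord0 = tinj0 E 1.
Proof. by move=> X0 Ss st tT; apply: X0; split. Qed.

Lemma chen_defectE X s u t (i : 'I_k.+1) : level0_one S T X -> (0 < i)%N ->
  S <= s -> s <= u -> u <= t -> t <= T ->
  ttmul (X (s, u)) (X (u, t)) i = X (s, u) i + X (u, t) i + cross i (X (s, u)) (X (u, t)).
Proof.
move=> X0 i0 Ss su ut tT.
by apply: ttmul_level => //; apply: level0_triangle => //;
  [exact: le_trans tT|exact: le_trans Ss _].
Qed.

Definition sub_levels X Y : path := fun st i => X st i - Y st i.

(** The multiplicative defect is a polynomial in the levels, and its two cross
    terms containing the difference X - Y keep its order because the other factor
    is bounded. *)
Lemma close_almost_chen X Y : level0_one S T X -> level0_one S T Y ->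
  level_order 0 Y -> close X Y -> almost_chen Y -> almost_chen X.
Proof.
move=> X0 Y0 bY cXY [t1 t11 aY].
have bX : level_order 0 X.
  by move=> j j0; apply: close_of_order cXY (bY j j0); rewrite // lexx ler01.
have [t2 t21 dXY] := cXY.
have th1 : 1 < Num.min t1 t2 by rewrite lt_min t11.
exists (Num.min t1 t2) => // i i0; set th := Num.min t1 t2 in th1 *.
have th0 : 0 <= th by rewrite ltW// (lt_trans ltr01).
have t1th : th <= t1 by rewrite ge_min lexx.
have t2th : th <= t2 by rewrite ge_min lexx orbT.
have dord : level_order th (sub_levels X Y).
  by move=> j j0; exact: of_order_weaken (dXY j j0).
have B0 := of_order_weaken th0 t1th (aY i i0).
have B1 := dord i i0.
have B2 := of_order_left th0 B1; have B3 := of_order_right th0 B1.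
have B4 := @of_order_cross th 0 _ _ i th0 (lexx 0) dord bX; rewrite addr0 in B4.
have B5 := @of_order_cross 0 th _ _ i (lexx 0) th0 bY dord; rewrite add0r in B5.
have B := of_orderD th0 B0 (of_orderD th0 B1 (of_orderD th0 B2 (of_orderD th0 B3
  (of_orderD th0 B4 B5)))).
apply: of_order_le B _ => s u t Ss su ut tT.
rewrite !chen_defectE//.
have c1 : cross i (X (s, u)) (X (u, t)) =
    cross i (sub_levels X Y (s, u)) (X (u, t)) + cross i (Y (s, u)) (X (u, t)).
  by apply: crossDl => j _; rewrite subrK.
have c2 : cross i (Y (s, u)) (X (u, t)) =
    cross i (Y (s, u)) (sub_levels X Y (u, t)) + cross i (Y (s, u)) (Y (u, t)).
  by apply: crossDr => j _; rewrite subrK.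
rewrite c1 c2 /sub_levels.
set ysu := Y (s, u) i; set yut := Y (u, t) i; set yst := Y (s, t) i.
set cdx := cross _ _ _; set cyd := cross _ _ _; set cyy := cross _ _ _.
rewrite -(subrK ysu (X (s, u) i)) -(subrK yut (X (u, t) i)) -(subrK yst (X (s, t) i)).
rewrite !addrK.
move: (X (s, u) i - ysu) (X (u, t) i - yut) (X (s, t) i - yst) => dsu dut dst.
rewrite (_ : _ - (dst + yst) = (ysu + yut + cyy - yst) + (- dst +
  (dsu + (dut + (cdx + cyd))))); last first.
  by rewrite opprD !addrA [LHS](ACl (2*4*7*9*8*1*3*5*6)).
apply: le_trans (ler_normD _ _) _; apply: lerD => //.
apply: le_trans (ler_normD _ _) _; rewrite normrN; apply: lerD => //.
apply: le_trans (ler_normD _ _) _; apply: lerD => //.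
apply: le_trans (ler_normD _ _) _; apply: lerD => //.
exact: ler_normD.
Qed.

(** By induction on the level: once the lower levels agree, so do the cross terms,
    and the difference on the current level is additive. *)
Lemma chen_unique X Y : level0_one S T X -> level0_one S T Y ->
  (forall i, chen_at S T X i) -> (forall i, chen_at S T Y i) -> close X Y ->
  forall st, triangle S T st -> X st = Y st.
Proof.
move=> X0 Y0 cX cY [th th1 dXY].
suff H n (i : 'I_k.+1) : (i <= n)%N ->
    forall s t, S <= s -> s <= t -> t <= T -> X (s, t) i = Y (s, t) i.
  move=> [s t] [/= Ss [st tT]]; apply: functional_extensionality_dep => i.
  exact: (H i).
elim: n i => [|n IH] i; first rewrite leqn0 => /eqP i0 s t Ss st tT.
  have -> : i = ord0 by exact/val_inj.
  by rewrite !(@level0_triangle _ s t).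
rewrite leq_eqVlt => /predU1P[iE|]; last exact: IH.
have i0 : (0 < i)%N by rewrite iE.
have IH' (j : 'I_k.+1) : (0 < j < i)%N -> (j <= n)%N by rewrite iE ltnS => /andP[].
move=> s t Ss st tT; apply/eqP; rewrite -subr_eq0; apply/eqP.
have leST : S <= T by rewrite (le_trans Ss)// (le_trans st).
apply: (@additive_small_eq0 _ _ _ leST _ th (fun s t => X (s, t) i - Y (s, t) i)) => //.
  move=> a b c Sa ab bc cT.
  rewrite -(cX i a b c)// -(cY i a b c)// !chen_defectE//.
  rewrite (@eq_cross _ _ _ _ i (X (a, b)) (Y (a, b)) (X (b, c)) (Y (b, c))).
  - by rewrite opprD addrACA subrr addr0 opprD addrACA.
  - by move=> j /IH' /IH; apply => //; exact: le_trans cT.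
  - by move=> j /IH' /IH; apply => //; exact: le_trans ab.
exact: dXY.
Qed.

End RoughSewing.

(** * Existence in the rough sewing lemma *)

Section SewingExistence.
Context {R : realType} {V : completeNormedModType R} {E : tensor_data V}.
Context (admE : admissible_tensor_powers E) (S T : R) (leST : S <= T) {k : nat}.
Local Notation path := (R * R -> ttensor E k).
Implicit Types X Y Z : path.

(** Correction of the lowest level at which Chen's identity fails.  The
    corrected level is I(s,t) minus the cross terms c(S,s,t), where I sews the germ
    Y(s,t) + c(S,s,t); by the cocycle identity, the additive defect of this germ
    is, up to sign, the multiplicative defect of Y. *)
Lemma sew_level (m : 'I_k.+1) Y : (0 < m)%N -> level0_one S T Y -> almost_chen S T Y ->
  (forall j : 'I_k.+1, (0 < j < m)%N -> chen_at S T Y j) ->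
  exists Y', [/\ level0_one S T Y', close S T Y' Y &
    forall j : 'I_k.+1, (0 < j <= m)%N -> chen_at S T Y' j].
Proof.
move=> m0 Y0 [th th1 aY] cY.
pose c s u t := cross m (Y (s, u)) (Y (u, t)).
have c_cocycle s u t : S <= s -> s <= u -> u <= t -> t <= T ->
    c S s u + c S u t = c s u t + c S s t.
  move=> Ss su ut tT; have Su := le_trans Ss su; have uT := le_trans ut tT.
  have sT := le_trans su uT.
  apply: (cross_cocycle admE) => //.
  - exact: (level0_triangle Y0).
  - exact: (level0_triangle Y0).
  - exact: (level0_triangle Y0).
  - by move=> j jm; rewrite (cY j jm).
  - by move=> j jm; rewrite (cY j jm).
pose A s t := Y (s, t) m + c S s t.
have AE s u t : S <= s -> s <= u -> u <= t -> t <= T ->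
    A s t - A s u - A u t = - (ttmul (Y (s, u)) (Y (u, t)) m - Y (s, t) m).
  move=> Ss su ut tT; rewrite (chen_defectE admE Y0 m0 Ss su ut tT) -/(c s u t) /A.
  have -> : c s u t = c S s u + c S u t - c S s t by rewrite c_cocycle// addrK.
  by rewrite !opprD !opprK !addrA [LHS](ACl (3*5*4*6*2*1)).
have [|I [th' [th'1 addI IA]]] := @additive_sewing _ S T leST _ th A th1.
  by apply: of_order_le (aY m m0) _ => s u t Ss su ut tT; rewrite AE// normrN.
pose Y' : path := fun st => dfwith (Y st) m (I st.1 st.2 - c S st.1 st.2).
have Y'm st : Y' st m = I st.1 st.2 - c S st.1 st.2 by rewrite /Y' dfwithin.
have Y'j st j : j != m -> Y' st j = Y st j by move=> jm; rewrite /Y' dfwithout// eq_sym.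
have Y'0 : level0_one S T Y'.
  by move=> st tr; rewrite Y'j ?Y0//; apply: contraTneq m0 => <-.
exists Y'; split=> //.
  exists th' => // i i0; have [->|im] := eqVneq i m.
    by apply: of_order_le IA _ => s u t *; rewrite Y'm /A opprD addrA addrAC.
  by apply: of_order_le (of_order0 S T th') _ => s u t *; rewrite Y'j// subrr normr0.
move=> j /andP[j0 jm] s u t Ss su ut tT.
rewrite (chen_defectE admE Y'0 j0 Ss su ut tT).
have -> : cross j (Y' (s, u)) (Y' (u, t)) = cross j (Y (s, u)) (Y (u, t)).
  by apply: eq_cross => l /andP[l0 lj]; rewrite Y'j//;
    apply: contraTneq jm => <-; rewrite -ltnNge.
have [->|jm'] := eqVneq j m; last first.
  have jm0 : (0 < j < m)%N by rewrite j0 ltn_neqAle jm andbT; exact: jm'.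
  by rewrite !Y'j// -(cY j jm0 s u t)// (chen_defectE admE Y0 j0 Ss su ut tT).
rewrite !Y'm/= -/(c s u t) (addI s u t)//.
have -> : c S s t = c S s u + c S u t - c s u t.
  by rewrite c_cocycle// addrAC subrr add0r.
by rewrite !opprD opprK !addrA [LHS](ACl (1*3*2*4*5)).
Qed.

(** Iterating [sew_level] up to the top level: each step stays close to Z, so the
    map remains almost multiplicative, by [close_almost_chen]. *)
Lemma rough_sewing Z : level0_one S T Z -> level_order S T 0 Z -> almost_chen S T Z ->
  exists Y, [/\ level0_one S T Y, close S T Y Z & forall i, chen_at S T Y i].
Proof.
move=> Z0 bZ aZ.
have H m : (m <= k)%N -> exists Y, [/\ level0_one S T Y, close S T Y Z &
    forall j : 'I_k.+1, (0 < j <= m)%N -> chen_at S T Y j].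
  elim: m => [_|m IH mk].
    by exists Z; split=> // [|j /andP[j0]]; [exact: close_refl|rewrite leqNgt j0].
  have [Y [Y0 YZ cY]] := IH (ltnW mk).
  have aY := close_almost_chen admE Y0 Z0 bZ YZ aZ.
  have [] // := @sew_level (Ordinal (mk : (m.+1 < k.+1)%N)) Y _ Y0 aY.
  move=> Y' [Y'0 Y'Y cY']; exists Y'; split=> //; exact: close_trans Y'Y YZ.
have [Y [Y0 YZ cY]] := H k (leqnn k); exists Y; split=> // i.
have [i0|] := boolP (0 < i)%N; first by apply: cY; rewrite i0 -ltnS ltn_ord.
rewrite -eqn0Ngt => /eqP i0 s u t Ss su ut tT.
have -> : i = ord0 by exact/val_inj.
rewrite (ttmul0 admE) ?(@level0_triangle _ _ _ S T _ Y)//.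
- exact: le_trans ut.
- exact: le_trans tT.
- exact: le_trans su.
Qed.

End SewingExistence.

(** * The constants normalizing p-variation *)

Section NormalizingConstants.
Context {R : realType}.
Notation mu := (@lebesgue_measure R).

(** The series has nonnegative terms, and its value is 0 by convention if it
    diverges, so that positivity does not depend on its convergence. *)
Lemma beta_const_gt0 (p : R) : 1 <= p -> 0 < beta_const p.
Proof.
move=> p1; apply: mulr_gt0; first exact: lt_le_trans p1.
apply: ltr_pwDl => //.
set u := fun n => _; have [cu|ncu] := pselect (cvgn u).
  apply: limr_ge => //; apply: nearW => n; rewrite /u; apply: sumr_ge0 => *.
  exact: powR_ge0.
by rewrite (dvgP ncu).
Qed.

(** The Gamma integral has to be shown finite, since otherwise its real value would
    be 0 by convention; on the range needed here, t^x is at most 1 + t, which the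
    exponential density of rate 1/2 dominates, up to a factor, after multiplication
    by exp(-t).  It is bounded below by its part over [1, 2]. *)
Lemma rfact_gt0 (x : R) : 0 <= x <= 1 -> 0 < rfact x.
Proof.
move=> /andP[x0 x1]; rewrite /rfact /Gamma addrK.
set f := fun t : R => t `^ x * expR (- t).
have D0 : measurable (`]0, +oo[%classic : set R) by [].
have f0 t : 0 <= f t by rewrite mulr_ge0 ?powR_ge0 ?expR_ge0.
have mf : measurable_fun (`]0, +oo[%classic : set R) f.
  apply: measurable_funM; first by apply: measurable_funTS; exact: measurable_powR.
  by apply: measurable_funTS; apply: measurableT_comp => //; exact: oppr_measurable.
have fle t : t \in `]0%R, +oo[ -> f t <= 8 * exponential_pdf 2^-1 t.
  rewrite in_itv/= andbT => t0; rewrite (exponential_pdfE _ (ltW t0)) /f.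
  have tx : t `^ x <= 1 + t.
    have [t1|t1] := leP 1 t.
      by apply: le_trans (ler1_powR t1 x1) _; lra.
    apply: le_trans (_ : t `^ x <= t `^ 0) _; last by rewrite powRr0; lra.
    by apply: ger_powR => //; rewrite t0 ltW.
  rewrite (_ : expR (- t) = expR (- 2^-1 * t) * expR (- 2^-1 * t)); last first.
    by rewrite -expRD; congr expR; field.
  set g := expR (- 2^-1 * t); have g0 : 0 < g by exact: expR_gt0.
  suff tg : t `^ x * g <= 4.
    by rewrite (_ : 8 * _ = 4 * g) ?mulrA ?ler_pM2r//; field.
  apply: le_trans (ler_wpM2r (ltW g0) tx) _.
  rewrite /g mulNr expRN ler_pdivrMr ?expR_gt0//.
  have := expR_ge1Dx (2^-1 * t); lra.
have fint : mu.-integrable `]0, +oo[ (EFin \o f).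
  apply: (@le_integrable _ _ _ mu _ D0 _
    (fun t => (8%:E * (exponential_pdf 2^-1 t)%:E)%E)).
  - exact/measurable_EFinP.
  - move=> t tD; rewrite -EFinM /= lee_fin ger0_norm//.
    by apply: le_trans (ler_norm _); apply: fle; rewrite inE in tD *.
  - apply: integrableZl => //.
    apply: (@integrableS _ _ _ mu setT) => //.
    by apply: integrable_exponential_pdf; rewrite invr_gt0.
have mEf : measurable_fun (`]0, +oo[%classic : set R) (EFin \o f) by exact/measurable_EFinP.
rewrite /Rintegral fine_gt0//; apply/andP; split; last first.
  case/integrableP : fint => _; apply: le_lt_trans; apply: ge0_le_integral => //=.
  - by move=> t _; rewrite lee_fin.
  - apply/measurable_EFinP.
    exact: (measurableT_comp (@normr_measurable R setT) mf).
  - by move=> t _; rewrite lee_fin ler_norm.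
apply: (@lt_le_trans _ _ (\int[mu]_(t in `[1%R, 2%R]%classic) (expR (- 2))%:E)%E).
  rewrite integral_cst//= lebesgue_measure_itv/= lte_fin ltr1n.
  by rewrite -EFinD -EFinM lte_fin mulr_gt0 ?expR_gt0//; lra.
apply: (@le_trans _ _ (\int[mu]_(t in `[1%R, 2%R]%classic) (f t)%:E)%E).
  apply: ge0_le_integral => //.
  - apply: (measurable_funS _ _ mEf) => // t /=; rewrite !in_itv/= andbT => /andP[t1 _].
    exact: lt_le_trans t1.
  - move=> t /=; rewrite in_itv/= => /andP[t1 t2]; rewrite lee_fin /f.
    rewrite -[leLHS]mul1r; apply: ler_pM => //; rewrite ?expR_ge0//.
      by rewrite -[leLHS](powRr0 t); apply: ler_powR.
    by rewrite ler_expR lerN2.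
apply: ge0_subset_integral => //.
- by move=> t _; rewrite lee_fin.
- move=> t /=; rewrite !in_itv/= andbT => /andP[t1 _]; exact: lt_le_trans t1.
Qed.

End NormalizingConstants.

(** * Rough paths and the operation boxplus *)

Section RoughPaths.
Context {R : realType} {V : completeNormedModType R} {E : tensor_data V}.
Context (admE : admissible_tensor_powers E) (S T : R) (leST : S <= T).
Context (p : R) (p_ge1 : 1 <= p).
Let k := Num.truncn p.
Local Notation path := (R * R -> ttensor E k).
Implicit Types X Y Z H : path.

Let p_gt0 : 0 < p. Proof. exact: lt_le_trans p_ge1. Qed.

Lemma level_exponent (i : 'I_k.+1) : 0 <= i%:R / p <= 1.
Proof.
rewrite divr_ge0 ?ler0n ?(ltW p_gt0)//= ler_pdivrMr// mul1r.
apply: le_trans (_ : k%:R <= p); last by rewrite truncn_le// ltW.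
by rewrite ler_nat leq_ord.
Qed.

Lemma level_exponent_inv (i : 'I_k.+1) : (0 < i)%N -> p^-1 <= i%:R / p.
Proof. by move=> i0; rewrite ler_peMl ?invr_ge0 ?(ltW p_gt0)// ler1n. Qed.

Lemma level_denominator_gt0 (i : 'I_k.+1) : 0 < beta_const p * rfact (i%:R / p).
Proof. by rewrite mulr_gt0 ?beta_const_gt0// rfact_gt0// level_exponent. Qed.

Definition variation_order X := forall i : 'I_k.+1, (0 < i)%N ->
  of_order S T (i%:R / p) (fun s _ t => `|X (s, t) i|).

Lemma variation_order_level X : variation_order X -> level_order S T p^-1 X.
Proof.
move=> oX i i0; apply: of_order_weaken (oX i i0); last exact: level_exponent_inv.
by rewrite invr_ge0 ltW// p_gt0.
Qed.

Lemma controlled_of_order w K (F : R -> R -> R) a : control S T w -> 0 <= a -> 0 <= K ->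
  (forall s t, S <= s -> s <= t -> t <= T -> F s t <= K * w (s, t) `^ a) ->
  of_order S T a (fun s _ t => F s t).
Proof.
move=> cw a0 K0 FK; have [h ch wh] := control_clock leST cw.
exists h, K; split=> // s u t Ss su ut tT; have st := le_trans su ut.
apply: le_trans (FK s t Ss st tT) _; apply: ler_wpM2l => //.
apply: powR_mono_base => //; last exact: wh.
by case: cw => _ w0 _ _; apply: w0; split.
Qed.

Lemma controlled_variation_order w K X : control S T w -> 0 <= K ->
  controlled_variation S T p w K X -> variation_order X.
Proof.
move=> cw K0 XK i i0; have d0 := level_denominator_gt0 i.
apply: (@controlled_of_order w (K / (beta_const p * rfact (i%:R / p)))) => //.
- by case/andP: (level_exponent i).
- by rewrite divr_ge0// ltW.
- move=> s t Ss st tT; rewrite mulrAC; apply: XK => //; by split.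
Qed.

(** The sum of all the normalizing factors dominates each of them, so one constant
    serves every level. *)
Lemma order_controlled_variation (h : R -> R) K X : clock h -> 0 <= K ->
  (forall i : 'I_k.+1, (0 < i)%N -> forall s t, S <= s -> s <= t -> t <= T ->
     `|X (s, t) i| <= K * (h t - h s) `^ (i%:R / p)) ->
  controlled_variation S T p (fun st => h st.2 - h st.1)
    (K * \sum_(i < k.+1) beta_const p * rfact (i%:R / p)) X.
Proof.
move=> ch K0 XK [s t] [/= Ss [st tT]] i i0; have d0 := level_denominator_gt0 i.
rewrite ler_pdivlMr//; apply: le_trans (ler_wpM2r (ltW d0) (XK i i0 s t Ss st tT)) _.
rewrite [leLHS]mulrAC; apply: ler_wpM2r; first exact: powR_ge0.
apply: ler_wpM2l => //; rewrite (bigD1 i)//= lerDl; apply: sumr_ge0 => j _.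
exact/ltW/level_denominator_gt0.
Qed.

(** Rough paths without their normalizing constants, which are absorbed in the
    constants of [of_order].  The right-hand side implies continuity by
    [chen_continuous]. *)
Lemma rough_pathP X : rough_path S T p X <->
  [/\ level0_one S T X, forall i, chen_at S T X i & variation_order X].
Proof.
split=> [[[_ X0 cX] [w [K [cw K0 XK]]]]|[X0 cX oX]].
  split=> //; last exact: controlled_variation_order XK.
  by move=> i s u t Ss su ut tT; rewrite cX.
split.
  split=> // [|s u t *]; last by apply: functional_extensionality_dep => i; exact: cX.
  apply: (@chen_continuous _ _ _ admE S T _ p^-1) => //.
    by rewrite invr_gt0 p_gt0.
  exact: variation_order_level.
have [||h [K [ch K0 HK]]] := @of_order_common _ S T 'I_k.+1 (fun i => i%:R / p)
  (fun i s _ t => if (0 < i)%N then `|X (s, t) i| else 0).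
- by move=> i; case/andP: (level_exponent i).
- move=> i; case: (boolP (0 < i)%N) => i0; first exact: oX.
  exact: of_order0.
exists (fun st => h st.2 - h st.1), (K * \sum_(i < k.+1) beta_const p * rfact (i%:R / p)).
split; first exact: clock_control.
  by rewrite mulr_ge0//; apply: sumr_ge0 => j _; exact/ltW/level_denominator_gt0.
apply: order_controlled_variation => // i i0 s t Ss st tT.
by have := HK i s s t Ss (lexx s) st tT; rewrite i0.
Qed.

Lemma is_sewingP Z Y : is_sewing S T Z Y ->
  [/\ level0_one S T Y, forall i, chen_at S T Y i & close S T Y Z].
Proof.
move=> [q [th [w [_ th1 cw _ [[[_ Y0 cY] _] [C YZ]]]]]]; split=> //.
  by move=> i s u t Ss su ut tT; rewrite cY.
exists th => // i i0; apply: (@controlled_of_order w `|C|) => //.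
  by rewrite ltW// (lt_trans ltr01).
move=> s t Ss st tT; apply: le_trans (YZ (s, t) _ i i0) _; first by split.
by apply: ler_wpM2r; [exact: powR_ge0|exact: ler_norm].
Qed.

(** The definition wants a single control and constant for the variation of Z, its
    defect and its distance to Y. *)
Lemma is_sewing_exists Z : level0_one S T Z -> variation_order Z -> almost_chen S T Z ->
  exists Y, is_sewing S T Z Y.
Proof.
move=> Z0 oZ aZ.
have Zp := variation_order_level oZ.
have bZ : level_order S T 0 Z.
  by apply: level_order_weaken Zp; rewrite // invr_ge0 ltW// p_gt0.
have [Y [Y0 YZ cY]] := rough_sewing admE leST Z0 bZ aZ.
have oY : variation_order Y.
  by move=> i i0; apply: close_of_order YZ (oZ i i0) => //; exact: level_exponent.
exists Y; have [t1 t11 aZi] := aZ; have [t2 t21 YZi] := YZ.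
pose th := Num.min t1 t2; have th1 : 1 < th by rewrite lt_min t11.
have th0 : 0 <= th by rewrite ltW// (lt_trans ltr01).
have tht1 : th <= t1 by rewrite ge_min lexx.
have tht2 : th <= t2 by rewrite ge_min lexx orbT.
(* the boolean tells the variation of Z from its defect and distance to Y *)
have [||h [K [ch K0 HK]]] := @of_order_common _ S T (bool * 'I_k.+1)%type
  (fun bi => if bi.1 then bi.2%:R / p else th)
  (fun bi s u t => if (0 < bi.2)%N then
     if bi.1 then `|Z (s, t) bi.2| else
       `|ttmul (Z (s, u)) (Z (u, t)) bi.2 - Z (s, t) bi.2| + `|Y (s, t) bi.2 - Z (s, t) bi.2|
   else 0).
- by move=> [[] i] //=; case/andP: (level_exponent i).
- move=> [b i] /=; case: (boolP (0 < i)%N) => i0; last exact: of_order0.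
  case: b; first exact: oZ.
  apply: of_orderD => //; first exact: of_order_weaken (aZi i i0).
  exact: of_order_weaken (YZi i i0).
exists p, th, (fun st => h st.2 - h st.1); split=> //; first exact: clock_control.
- split=> //; pose K' := K * \sum_(i < k.+1) beta_const p * rfact (i%:R / p).
  have K'0 : 0 <= K'.
    by rewrite mulr_ge0//; apply: sumr_ge0 => j _; exact/ltW/level_denominator_gt0.
  have wpos s t : S <= s -> s <= t -> t <= T -> 0 <= h t - h s.
    by move=> _ st _; rewrite subr_ge0 clock_le.
  exists (K + K'); split; first exact: addr_ge0.
    move=> st tr i i0; have d0 := level_denominator_gt0 i.
    apply: le_trans (@order_controlled_variation h K Z ch K0 _ st tr i i0) _.
      move=> j j0 s t Ss st' tT.
      by have := HK (true, j) s s t Ss (lexx s) st' tT; rewrite /= j0.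
    apply: ler_wpM2r; first by rewrite invr_ge0 ltW.
    by apply: ler_wpM2r; [exact: powR_ge0|rewrite lerDr].
  move=> s u t Ss su ut tT i i0 /=.
  have := HK (false, i) s u t Ss su ut tT; rewrite /= i0 => HKi.
  apply: le_trans (_ : K * (h t - h s) `^ th <= _).
    by apply: le_trans HKi; rewrite lerDl.
  by apply: ler_wpM2r; [exact: powR_ge0|rewrite lerDl].
- split; first exact/rough_pathP.
  exists K => -[s t] [/= Ss [st tT]] i i0.
  have := HK (false, i) s s t Ss (lexx s) st tT; rewrite /= i0; apply: le_trans.
  by rewrite lerDr.
Qed.

Lemma sewingP Z : level0_one S T Z -> variation_order Z -> almost_chen S T Z ->
  [/\ level0_one S T (sewing S T Z), forall i, chen_at S T (sewing S T Z) i &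
      close S T (sewing S T Z) Z].
Proof.
by move=> Z0 oZ aZ; apply: is_sewingP; apply: getPex; exact: is_sewing_exists.
Qed.

Lemma oplus_level0 X H : level0_one S T (oplus X H).
Proof. by []. Qed.

Lemma oplus_level X H st (i : 'I_k.+1) : (0 < i)%N -> oplus X H st i = X st i + H st i.
Proof. by rewrite /oplus lt0n => /negbTE ->. Qed.

Lemma HspaceP H : Hspace S T p H <->
  [/\ level0_one S T H, forall i, chen_at S T H i, variation_order H &
    exists2 phi, 1 - p^-1 < phi <= 1 & level_order S T phi H].
Proof.
split=> [[/rough_pathP[H0 cH oH] [w [phi [K [cw phi0 phi1 K0 HK]]]]]|].
  split=> //; exists phi; rewrite ?phi0// => i i0.
  apply: (@controlled_of_order w K) => //.
    by apply: le_trans (ltW phi0); rewrite subr_ge0 invf_le1 ?p_gt0.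
  by move=> s t Ss st tT; apply: HK => //; split.
move=> [H0 cH oH [phi /andP[phi0 phi1] Hphi]]; split; first exact/rough_pathP.
have phige0 : 0 <= phi by apply: le_trans (ltW phi0); rewrite subr_ge0 invf_le1 ?p_gt0.
have [||h [K [ch K0 HK]]] := @of_order_common _ S T 'I_k.+1 (fun=> phi)
  (fun i s _ t => if (0 < i)%N then `|H (s, t) i| else 0) => //.
  move=> i; case: (boolP (0 < i)%N) => i0; first exact: Hphi.
  exact: of_order0.
exists (fun st => h st.2 - h st.1), phi, K; split=> //; first exact: clock_control.
move=> [s t] [/= Ss [st tT]] i i0.
by have := HK i s s t Ss (lexx s) st tT; rewrite i0.
Qed.

Lemma oplus_variation_order X H : variation_order X -> variation_order H ->
  variation_order (oplus X H).
Proof.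
move=> oX oH i i0; have /andP[a0 _] := level_exponent i.
apply: of_order_le (of_orderD a0 (oX i i0) (oH i i0)) _ => s u t *.
by rewrite oplus_level// ler_normD.
Qed.

(** The products of X with itself and of H with itself are accounted for by Chen's
    identity for X and H; what remains are the mixed products, of order at least
    1/p + phi. *)
Lemma oplus_almost_chen X H phi : 1 - p^-1 < phi ->
  level0_one S T X -> (forall i, chen_at S T X i) -> variation_order X ->
  level0_one S T H -> (forall i, chen_at S T H i) -> level_order S T phi H ->
  almost_chen S T (oplus X H).
Proof.
move=> phi0 X0 cX /variation_order_level oX H0 cH oH.
have pi0 : 0 <= p^-1 by rewrite invr_ge0 ltW// p_gt0.
have phige0 : 0 <= phi by apply: le_trans (ltW phi0); rewrite subr_ge0 invf_le1 ?p_gt0.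
exists (p^-1 + phi); first by rewrite -ltrBlDl.
move=> i i0.
have B1 := of_order_cross admE i pi0 phige0 oX oH.
have B2 := of_order_cross admE i phige0 pi0 oH oX; rewrite addrC in B2.
apply: of_order_le (of_orderD (addr_ge0 pi0 phige0) B1 B2) _ => s u t Ss su ut tT.
rewrite (chen_defectE admE (oplus_level0 X H) i0 Ss su ut tT).
have oplusE st (j : 'I_k.+1) : (0 < j)%N -> oplus X H st j = X st j + H st j.
  exact: oplus_level.
rewrite (crossDl _ _ (oplusE (s, u))) !(crossDr _ _ (oplusE (u, t))).
rewrite !oplus_level// -(cX i s u t)// -(cH i s u t)//.
rewrite (chen_defectE admE X0 i0 Ss su ut tT) (chen_defectE admE H0 i0 Ss su ut tT).
set xh := cross _ (X _) (H _); set hx := cross _ (H _) (X _).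
set xx := cross _ _ _; set hh := cross _ _ _.
rewrite (_ : _ - _ = xh + hx); first exact: ler_normD.
move: (X (s, u) i) (X (u, t) i) (H (s, u) i) (H (u, t) i) => a b c d.
apply/eqP; rewrite subr_eq; apply/eqP.
by rewrite !addrA [LHS](ACl (6*7*1*3*5*2*4*8)).
Qed.

Lemma boxplusP X H : rough_path S T p X -> Hspace S T p H ->
  rough_path S T p (boxplus S T X H) /\ close S T (boxplus S T X H) (oplus X H).
Proof.
move=> /rough_pathP[X0 cX oX] /HspaceP[H0 cH oH [phi /andP[phi0 _] Hphi]].
have oZ := oplus_variation_order oX oH.
have aZ := oplus_almost_chen phi0 X0 cX oX H0 cH Hphi.
have [Y0 cY YZ] := sewingP (oplus_level0 X H) oZ aZ; split=> //.
apply/rough_pathP; split=> // i i0.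
by apply: close_of_order YZ (oZ i i0) => //; exact: level_exponent.
Qed.

Lemma boxplus_Hspace X H : Hspace S T p X -> Hspace S T p H ->
  Hspace S T p (boxplus S T X H).
Proof.
move=> HX HH; have [rY cY] := boxplusP HX.1 HH.
have /HspaceP[_ _ _ [f1 /andP[f10 f11] of1]] := HX.
have /HspaceP[_ _ _ [f2 /andP[f20 f21] of2]] := HH.
have /rough_pathP[Y0 chY oY] := rY; apply/HspaceP; split=> //.
exists (Num.min f1 f2); first by rewrite lt_min f10 f20 ge_min f11.
have m0 : 0 <= Num.min f1 f2.
  have pp : 0 <= 1 - p^-1 by rewrite subr_ge0 invf_le1 ?p_gt0.
  by rewrite le_min !(le_trans pp (ltW _)).
move=> i i0; apply: close_of_order cY _ => //; first by rewrite m0 ge_min f11.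
have B1 := of_order_weaken m0 (_ : Num.min f1 f2 <= f1) (of1 i i0).
have B2 := of_order_weaken m0 (_ : Num.min f1 f2 <= f2) (of2 i i0).
apply: of_order_le (of_orderD m0 (B1 _) (B2 _)) _ => [||s u t *].
- by rewrite ge_min lexx.
- by rewrite ge_min lexx orbT.
- by rewrite oplus_level// ler_normD.
Qed.

Lemma close_oplus X X' H H' : close S T X X' -> close S T H H' ->
  close S T (oplus X H) (oplus X' H').
Proof.
have addr X1 X2 Y : close S T X1 X2 -> close S T (oplus X1 Y) (oplus X2 Y).
  move=> [th th1 d]; exists th => // i i0; apply: of_order_le (d i i0) _ => s u t *.
  by rewrite !oplus_level// opprD addrACA subrr addr0.
have addl X1 Y1 Y2 : close S T Y1 Y2 -> close S T (oplus X1 Y1) (oplus X1 Y2).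
  move=> [th th1 d]; exists th => // i i0; apply: of_order_le (d i i0) _ => s u t *.
  by rewrite !oplus_level// opprD addrACA subrr add0r.
by move=> cX cH; apply: close_trans (addr _ _ H cX) (addl _ _ _ cH).
Qed.

Lemma oplusA X H H' : oplus (oplus X H) H' = oplus X (oplus H H').
Proof.
apply: funext => st; apply: functional_extensionality_dep => i.
by rewrite /oplus; case: eqP => // _; rewrite addrA.
Qed.

End RoughPaths.

Theorem theorem5p2 (R : realType) (S T : R) (leST : S <= T)
  (V : completeNormedModType R) (E : tensor_data V)
  (admE : admissible_tensor_powers E)
  (p : R) (p_ge1 : 1 <= p)
  (X H H' : R * R -> ttensor E (Num.truncn p)) :
  rough_path S T p X -> Hspace S T p H -> Hspace S T p H' ->
  forall st, triangle S T st ->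
    boxplus S T (boxplus S T X H) H' st = boxplus S T X (boxplus S T H H') st.
Proof.
move=> rX hH hH'.
have [rXH cXH] := boxplusP admE leST p_ge1 rX hH.
have [_ cHH'] := boxplusP admE leST p_ge1 hH.1 hH'.
have hHH' := boxplus_Hspace admE leST p_ge1 hH hH'.
have [rL cL] := boxplusP admE leST p_ge1 rXH hH'.
have [rR cR] := boxplusP admE leST p_ge1 rX hHH'.
have [L0 chL _] := (rough_pathP admE leST p_ge1 _).1 rL.
have [R0 chR _] := (rough_pathP admE leST p_ge1 _).1 rR.
apply: (chen_unique admE) => //.
apply: close_trans cL _; apply: close_trans (close_sym cR).
apply: close_trans (close_oplus cXH (close_refl S T H')) _.
rewrite oplusA; apply: close_oplus; first exact: close_refl.
exact: close_sym.
Qed.
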